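(* Consider the primal problem $$\min_{X\in\mathbb{X}}\ \Phi(X):=h(\mathcal{F}X)+\langle C,X\rangle+\theta(X)\quad\text{s.t.}\quad\mathcal{A}X\in b+\mathcal{Q},$$ where $\theta$ is a spectral function, either $\theta=g\circ\sigma$ with $g$ proper closed convex and absolutely symmetric, or (with $\mathbb{X}=\mathbb{S}^n$) $\theta=g\circ\lambda$ with $g$ proper closed convex and symmetric. Let $\overline{X}$ be an optimal solution of this problem with $\mathcal{M}_P(\overline{X})\ne\emptyset$. Assume that: (a) $h$ is strongly convex on any compact subset of $\mathrm{dom}\,h$; (b) if $\theta=g\circ\sigma$: for any $\bar v\in\partial g(\sigma(\overline{X}))$, the mapping $\partial g$ is metrically subregular at $\sigma(\overline{X})$ for $\bar v$; respectively, if $\theta=g\circ\lambda$: for any $\bar v\in\partial g(\lambda(\overline{X}))$, the mapping $\partial g$ is metrically subregular at $\lambda(\overline{X})$ for $\bar v$; (c) the collection of sets $\{\mathcal{V}_P,\mathcal{G}^1_P(\bar y),\mathcal{G}^2_P(\bar y)\}$ is boundedly linearly regular for some $\bar y\in\mathcal{M}_P(\overline{X})$. Then the quadratic growth condition holds at $\overline{X}$: there exist constants $\delta_p>0$ and $\kappa_p>0$ such that $$\Phi(X)\ge\Phi(\overline{X})+\kappa_p\,\mathrm{dist}^2(X,\Omega_P)\qquad\forall\,X\in F_P\cap\mathbb{B}_{\delta_p}(\overline{X}).$$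
   Context: Setting. $\mathbb{X}$ is either $\mathbb{R}^{n\times m}$ ($n\le m$) or the space $\mathbb{S}^n$ of real symmetric $n\times n$ matrices, with the trace inner product and the induced norm. $C\in\mathbb{X}$, $b\in\mathbb{R}^e$; $\mathcal{F}:\mathbb{X}\to\mathbb{R}^d$ and $\mathcal{A}:\mathbb{X}\to\mathbb{R}^e$ are linear with adjoints $\mathcal{F}^*,\mathcal{A}^*$; $h:\mathbb{R}^d\to(-\infty,+\infty]$ is convex and continuously differentiable on $\mathrm{dom}\,h$, which is a nonempty open convex set; $\theta:\mathbb{X}\to(-\infty,+\infty]$ is proper closed convex; $\mathcal{Q}\subseteq\mathbb{R}^e$ is a convex polyhedral cone with dual cone $\mathcal{Q}^*=\{y\mid\langle y,z\rangle\ge0\ \forall z\in\mathcal{Q}\}$. The dual problem is $\min_{(y,w,S)\in\mathbb{R}^e\times\mathbb{R}^d\times\mathbb{X}}\ \delta_{\mathcal{Q}^*}(y)-\langle b,y\rangle+h^*(-w)+\theta^*(-S)$ s.t. $\mathcal{A}^*y+\mathcal{F}^*w+S=C$ ($\delta$ an indicator function, $^*$ on functions the conjugate). Standing assumption: the optimal solution sets $\Omega_P$ of the primal problem and $\Omega_D$ of the dual problem are nonempty. $F_P=\{X\in\mathbb{X}\mid\mathcal{A}X\in b+\mathcal{Q}\}$. $\mathbb{B}_\rho(u)$ is the closed ball of radius $\rho$ centered at $u$; $\mathrm{dist}$ is the Euclidean distance to a set (equal to $+\infty$ for the empty set). Strong convexity of $h$ on compact subsets of $\mathrm{dom}\,h$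 is understood as strong convexity on every convex compact subset of $\mathrm{dom}\,h$ (the modulus may depend on the subset). Spectral functions. $\sigma(X)$ is the vector of singular values of $X\in\mathbb{X}$, and $\lambda(X)$ the vector of eigenvalues of $X\in\mathbb{S}^n$, in non-increasing order. $g:\mathbb{R}^n\to(-\infty,+\infty]$ is symmetric (resp. absolutely symmetric) if $g(Qx)=g(x)$ for all $x$ and all permutation (resp. signed permutation) matrices $Q$. Multipliers. $\mathcal{M}_P(\overline{X})$ is the set of $\bar y\in\mathbb{R}^e$ such that $0\in C-\mathcal{A}^*\bar y+\mathcal{F}^*\nabla h(\mathcal{F}\overline{X})+\partial\theta(\overline{X})$ and $0\in\mathcal{A}\overline{X}-b+\mathcal{N}_{\mathcal{Q}^*}(\bar y)$, where $\mathcal{N}_{\mathcal{Q}^*}$ is the normal cone of convex analysis. The sets in (c). Under (a), $\mathcal{F}X$ takes the same value for all $X\in\Omega_P$; put $\bar\xi:=\mathcal{F}\overline{X}$ and $\bar\eta:=\mathcal{F}^*\nabla h(\mathcal{F}\overline{X})+C$. Then $\mathcal{V}_P:=\{X\in\mathbb{X}\mid\mathcal{F}X=\bar\xi\}$, $\mathcal{G}^1_P(y):=(\partial\theta)^{-1}(\mathcal{A}^*y-\bar\eta)=\{X\in\mathbb{X}\mid\mathcal{A}^*y-\bar\eta\in\partial\theta(X)\}$, and $\mathcal{G}^2_P(y):=\{X\in\mathbb{X}\mid0\in\mathcal{A}X-b+\mathcal{N}_{\mathcal{Q}^*}(y)\}$ for $y\in\mathbb{R}^e$. Bounded linear regularity.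 Closed convex sets $D_1,\dots,D_s$ with nonempty intersection $D$ form a boundedly linearly regular collection if for every bounded set $\mathcal{B}$ there is $\kappa>0$ such that $\mathrm{dist}(x,D)\le\kappa\max_{1\le i\le s}\mathrm{dist}(x,D_i)$ for all $x\in\mathcal{B}$. Metric subregularity. A set-valued mapping $G:\mathbb{U}\rightrightarrows\mathbb{V}$ is metrically subregular at $\bar u$ for $\bar v$ if $\bar v\in G(\bar u)$ and there exist $\delta,\varepsilon,\kappa>0$ such that $\mathrm{dist}(u,G^{-1}(\bar v))\le\kappa\,\mathrm{dist}(\bar v,G(u)\cap\mathbb{B}_\delta(\bar v))$ for all $u\in\mathbb{B}_\varepsilon(\bar u)$. *)

(* Defs.v *)
From HB Require Import structures.
From mathcomp Require Import all_boot all_order all_algebra complex.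
From mathcomp Require Import all_classical all_reals all_analysis.
From mathcomp Require Import ring.

Set Implicit Arguments.
Unset Strict Implicit.
Unset Printing Implicit Defensive.

Import Order.TTheory GRing.Theory Num.Theory.
Import numFieldNormedType.Exports.

Local Open Scope classical_set_scope.
Local Open Scope ring_scope.

(* Finite-dimensional real inner product spaces; the norm is the one induced
   by the inner product [dotp], and it generates the topology. *)
HB.mixin Record isEuclidean (R : realType) E
    & NormedModule R E & Vector R E := {
  dotp : E -> E -> R ;
  dotpC : forall u v, dotp u v = dotp v u ;
  dotpDl : forall u v w, dotp (u + v) w = dotp u w + dotp v w ;
  dotpZl : forall (a : R) u v, dotp (a *: u) v = a * dotp u v ;
  dotp_norm : forall u, dotp u u = `|u| ^+ 2
}.

#[short(type="euclidType")]
HB.structure Definition Euclidean (R : realType) :=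
  {E of NormedModule R E & Vector R E & isEuclidean R E}.

HB.factory Record Vector_isEuclidean (R : realType) E & Vector R E := {
  dot : E -> E -> R ;
  dotC : forall u v, dot u v = dot v u ;
  dotDl : forall u v w, dot (u + v) w = dot u w + dot v w ;
  dotZl : forall (a : R) u v, dot (a *: u) v = a * dot u v ;
  dot_ge0 : forall u, 0 <= dot u u ;
  dot_eq0 : forall u, dot u u = 0 -> u = 0
}.

HB.builders Context R E & Vector_isEuclidean R E.

Let norm u : R := Num.sqrt (dot u u).

Let norm2 u : norm u ^+ 2 = dot u u.
Proof. by rewrite sqr_sqrtr ?dot_ge0. Qed.

Let dot0l v : dot 0 v = 0.
Proof. by rewrite -(scale0r (0 : E)) dotZl mul0r. Qed.

Let dotDr u v w : dot u (v + w) = dot u v + dot u w.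
Proof. by rewrite dotC dotDl !(dotC u). Qed.

Let dotZr a u v : dot u (a *: v) = a * dot u v.
Proof. by rewrite dotC dotZl dotC. Qed.

Let cauchy_schwarz u v : dot u v <= norm u * norm v.
Proof.
have [v0|vN0] := eqVneq (dot v v) 0.
  by rewrite (dot_eq0 v0) dotC dot0l mulr_ge0 ?sqrtr_ge0.
have v_gt0 : 0 < dot v v by rewrite lt_neqAle eq_sym vN0 dot_ge0.
have := dot_ge0 (dot v v *: u + (- dot u v) *: v).
rewrite !(dotDl, dotDr, dotZl, dotZr) (dotC v u).
rewrite (_ : _ + _ = dot v v * (dot u u * dot v v - dot u v ^+ 2)); last by ring.
rewrite pmulr_rge0// subr_ge0 -!norm2 -exprMn => le2.
have [uv0|uv0] := lerP (dot u v) 0.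
  by apply: le_trans uv0 _; rewrite mulr_ge0 ?sqrtr_ge0.
by rewrite -ler_sqr ?nnegrE ?mulr_ge0 ?sqrtr_ge0 ?(ltW uv0).
Qed.

Let norm_triangle u v : norm (u + v) <= norm u + norm v.
Proof.
rewrite -ler_sqr ?nnegrE ?addr_ge0 ?sqrtr_ge0//.
rewrite norm2 dotDl !dotDr sqrrD !norm2 (dotC v u) mulr2n -!addrA.
by rewrite lerD2l !addrA lerD2r lerD ?cauchy_schwarz.
Qed.

Let norm_scale (a : R) u : norm (a *: u) = `|a| * norm u.
Proof.
by rewrite /norm dotZl dotZr mulrA -expr2 sqrtrM ?sqr_ge0// sqrtr_sqr.
Qed.

Let norm_eq0 u : norm u = 0 -> u = 0.
Proof. by move=> u0; apply: dot_eq0; rewrite -norm2 u0 expr0n. Qed.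

HB.instance Definition _ :=
  @Lmodule_isNormed.Build R E norm norm_triangle norm_scale norm_eq0.

Let dot_norm u : dot u u = `|u| ^+ 2.
Proof. by rewrite -norm2. Qed.

HB.instance Definition _ :=
  @isEuclidean.Build R E dot dotC dotDl dotZl dot_norm.

HB.end.

(* A copy of ['M[R]_(m, n)] that carries the trace inner product and the
   Frobenius norm; ['M[R]_(m, n)] itself is normed by the maximum norm. *)
Definition emx (R : realType) (m n : nat) : Type := 'M[R]_(m, n).

HB.instance Definition _ (R : realType) m n := Vector.on (emx R m n).

Section EuclideanMatrices.
Context (R : realType) (m n : nat).
Implicit Types A B : emx R m n.

Definition mxdot A B : R := \tr (A^T *m B).

Lemma mxdotE A B : mxdot A B = \sum_i \sum_j A i j * B i j.
Proof.
rewrite /mxdot /mxtrace exchange_big/=; apply: eq_bigr => j _.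
by rewrite mxE; apply: eq_bigr => i _; rewrite mxE.
Qed.

Let mxdotC A B : mxdot A B = mxdot B A.
Proof.
by rewrite !mxdotE; do 2 (apply: eq_bigr => ? _); rewrite mulrC.
Qed.

Let mxdotDl A B C : mxdot (A + B) C = mxdot A C + mxdot B C.
Proof. by rewrite /mxdot linearD mulmxDl linearD. Qed.

Let mxdotZl (a : R) A B : mxdot (a *: A) B = a * mxdot A B.
Proof. by rewrite /mxdot linearZ -scalemxAl linearZ. Qed.

Let mxdot_ge0 A : 0 <= mxdot A A.
Proof. by rewrite mxdotE; do 2 (apply: sumr_ge0 => ? _); rewrite -expr2 sqr_ge0. Qed.

Let mxdot_eq0 A : mxdot A A = 0 -> A = 0.
Proof.
rewrite mxdotE => /eqP; rewrite psumr_eq0; last first.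
  by move=> i _; apply: sumr_ge0 => j _; rewrite -expr2 sqr_ge0.
move=> /allP A0; apply/matrixP => i j.
have /= := A0 i (mem_index_enum i); rewrite psumr_eq0; last first.
  by move=> k _; rewrite -expr2 sqr_ge0.
move=> /allP /(_ j (mem_index_enum j)) /=.
by rewrite -expr2 sqrf_eq0 => /eqP ->; rewrite mxE.
Qed.

HB.instance Definition _ := @Vector_isEuclidean.Build R (emx R m n)
  mxdot mxdotC mxdotDl mxdotZl mxdot_ge0 mxdot_eq0.

End EuclideanMatrices.

Notation vec R n := (emx R n 1).

Section EuclideanSubspaces.
Context (R : realType) (E : euclidType R) (V : {vspace E}).
Implicit Types u v : subvs_of V.

Definition subdot u v : R := dotp (vsval u) (vsval v).

Let subdotC u v : subdot u v = subdot v u.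
Proof. exact: dotpC. Qed.

Let subdotDl u v w : subdot (u + v) w = subdot u w + subdot v w.
Proof. exact: dotpDl. Qed.

Let subdotZl (a : R) u v : subdot (a *: u) v = a * subdot u v.
Proof. exact: dotpZl. Qed.

Let subdot_ge0 u : 0 <= subdot u u.
Proof. by rewrite /subdot dotp_norm sqr_ge0. Qed.

Let subdot_eq0 u : subdot u u = 0 -> u = 0.
Proof.
rewrite /subdot dotp_norm => /eqP; rewrite sqrf_eq0 normr_eq0 => /eqP u0.
exact/val_inj.
Qed.

HB.instance Definition _ := @Vector_isEuclidean.Build R (subvs_of V)
  subdot subdotC subdotDl subdotZl subdot_ge0 subdot_eq0.

End EuclideanSubspaces.

Definition symv (R : realType) (n : nat) : {vspace emx R n n} :=
  fixedSpace (linfun (@trmx R n n : emx R n n -> emx R n n)).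

Lemma symvP (R : realType) (n : nat) (A : emx R n n) :
  reflect (A^T = A) (A \in symv R n).
Proof. by apply: (iffP fixedSpaceP); rewrite lfunE. Qed.

Definition symmx (R : realType) (n : nat) := subvs_of (symv R n).

HB.instance Definition _ (R : realType) n := Euclidean.on (symmx R n).

Section EuclideanTheory.
Context (R : realType) (E : euclidType R).

Lemma edist_norm (x y : E) : edist (x, y) = `|x - y|%:E.
Proof.
apply/eqP; rewrite eq_le; apply/andP; split.
  apply/lee_addgt0Pr => e e0; rewrite -EFinD; apply: edist_fin.
    by rewrite ltr_wpDl.
  by rewrite -ball_normE/= ltrDl.
apply: le_ereal_inf_tmp => _ [r [r0 /=]] + <-.
by rewrite -ball_normE/= lee_fin => /ltW.
Qed.

Lemma dotpDr (u v w : E) : dotp u (v + w) = dotp u v + dotp u w.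
Proof. by rewrite dotpC dotpDl !(dotpC u). Qed.

Lemma dotpZr (a : R) (u v : E) : dotp u (a *: v) = a * dotp u v.
Proof. by rewrite dotpC dotpZl dotpC. Qed.

HB.instance Definition _ (v : E) := GRing.isLinear.Build R E R^o *:%R
  (dotp v) (fun a u w => etrans (dotpDr v (a *: u) w)
                                (congr1 (+%R^~ _) (dotpZr a v u))).

Let coords (v : E) : 'rV[R]_(\dim {:E}) := \row_i dotp (vbasis {:E})`_i v.

Let coords_linear : linear coords.
Proof. by move=> a u v; apply/rowP => i; rewrite !mxE linearP. Qed.

HB.instance Definition _ := GRing.isLinear.Build R E _ *:%R coords coords_linear.

Lemma riesz (phi : {linear E -> R^o}) : exists v : E, forall u, phi u = dotp v u.
Proof.
have expand (f : {linear E -> R^o}) u :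
    f u = \sum_i coord (vbasis {:E}) i u * f (vbasis {:E})`_i.
  rewrite {1}(coord_vbasis (memvf u)) linear_sum/=.
  by apply: eq_bigr => i _; rewrite linearZ.
have inj0 (w : E) : (forall i : 'I_(\dim {:E}), dotp (vbasis {:E})`_i w = 0) -> w = 0.
  move=> w0; apply/eqP; rewrite -normr_eq0 -sqrf_eq0 -dotp_norm.
  rewrite (expand (dotp w))/=; apply/eqP/big1 => i _.
  by rewrite dotpC w0 mulr0.
have inj : lker (linfun coords) == 0%VS.
  apply/lker0P => u v; rewrite !lfunE/= => /rowP uv.
  apply/eqP; rewrite -subr_eq0; apply/eqP/inj0 => i; rewrite linearB/=.
  by apply/eqP; rewrite subr_eq0; apply/eqP; have := uv i; rewrite !mxE.
have surj : limg (linfun coords) = fullv.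
  apply/eqP; rewrite eqEdim subvf/= limg_dim_eq; last by rewrite (eqP inj) capv0.
  by rewrite !dimvf/= /dim/= mul1n.
have /memv_imgP[v _ vE] : \row_i phi (vbasis {:E})`_i \in limg (linfun coords).
  by rewrite surj memvf.
exists v => u; rewrite (expand phi) (expand (dotp v)); apply: eq_bigr => i _.
by move/rowP: vE => /(_ i); rewrite lfunE !mxE => ->; rewrite /= dotpC.
Qed.

End EuclideanTheory.

Section ConvexAnalysis.
Context (R : realType) (E : euclidType R).
Implicit Types (f : E -> \bar R) (D K : set E) (x y : E).

Definition edom f : set E := [set x | (f x < +oo)%E].

Definition proper_fun f := (forall x, (-oo < f x)%E) /\ edom f !=set0.

Definition convex_efun f := forall x y (t : R), 0 <= t <= 1 ->
  (f (t *: x + (1 - t) *: y)%R <= t%:E * f x + (1 - t)%:E * f y)%E.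

Definition strongly_convex_on f K := exists2 mu : R, 0 < mu &
  forall x y (t : R), K x -> K y -> 0 <= t <= 1 ->
  (f (t *: x + (1 - t) *: y)%R + (mu / 2 * t * (1 - t) * `|x - y| ^+ 2)%:E
   <= t%:E * f x + (1 - t)%:E * f y)%E.

Definition eindic D x : \bar R := if x \in D then 0%E else +oo%E.

Definition conjugate f : E -> \bar R :=
  fun v => ereal_sup [set ((dotp v x)%:E - f x)%E | x in setT].

(* Empty outside the domain of a proper function. *)
Definition subdiff f x : set E :=
  [set v | forall y, (f x + (dotp v (y - x))%:E <= f y)%E].

Definition normal_cone K x : set E :=
  [set v | K x /\ forall y, K y -> dotp v (y - x) <= 0].

Definition dual_cone K : set E := [set y | forall z, K z -> 0 <= dotp y z].

Definition polyhedral_cone K := exists k (a : 'I_k -> E),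
  K = [set z | forall i, 0 <= dotp (a i) z].

Definition gradient (f : E -> R^o) x : E :=
  xget 0 [set v | forall u, 'd f x u = dotp v u].

Lemma gradientP (f : E -> R^o) x u : 'd f x u = dotp (gradient f x) u.
Proof.
exact: (@xgetPex _ 0 [set v | forall u, 'd f x u = dotp v u] (riesz ('d f x))).
Qed.

(* Meant for open D, where continuity at points of D is continuity on D. *)
Definition C1_on D (f : E -> R^o) := forall x, D x ->
  differentiable f x /\ {for x, continuous (gradient f)}.

(* Distances are nonnegative, so 0 is a neutral starting value for the max. *)
Definition bounded_linear_regular s (D : 'I_s -> set E) :=
  [/\ forall i, closed (D i),
      forall i, convex_set (D i : set (convex_lmodType E)),
      \bigcap_i D i !=set0 &
      forall B : set E, bounded_set B -> exists2 kappa : R, 0 < kappa &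
        forall x, B x -> (edist_inf (\bigcap_i D i) x
          <= kappa%:E * \big[maxe/0]_(i < s) edist_inf (D i) x)%E].

End ConvexAnalysis.

(* Only points with a finite value count as minimizers, so that [argmin] is
   empty when [f] is identically [+oo] on [D]. *)
Definition argmin (R : realType) T (f : T -> \bar R) (D : set T) : set T :=
  [set x | [/\ D x, f x \is a fin_num & forall y, D y -> (f x <= f y)%E]].

Section TwoSpaces.
Context (R : realType) (E E' : euclidType R).

Definition adjoint (f : E -> E') (y : E') : E :=
  xget 0 [set x | forall u, dotp (f u) y = dotp u x].

Lemma adjointP (f : {linear E -> E'}) u y :
  dotp (f u) y = dotp u (adjoint f y).
Proof.
have [x xP] := riesz (dotp y \o f : {linear E -> R^o}).
apply: (@xgetPex _ 0 [set x | forall u, dotp (f u) y = dotp u x]); exists x.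
by move=> v /=; rewrite dotpC [RHS]dotpC -xP.
Qed.

Definition metrically_subregular (G : E -> set E') (u0 : E) (v0 : E') :=
  G u0 v0 /\ exists delta eps kappa : R,
    [/\ 0 < delta, 0 < eps, 0 < kappa &
    forall u, closed_ball u0 eps u ->
      (edist_inf [set u' | G u' v0] u
       <= kappa%:E * edist_inf (G u `&` closed_ball v0 delta) v0)%E].

End TwoSpaces.

Section Spectra.
Context (R : realType).

Definition is_eigvals n (A : 'M[R]_n) (v : vec R n) :=
  (forall i j : 'I_n, (i <= j)%N -> v j 0 <= v i 0) /\
  char_poly A = \prod_i ('X - (v i 0)%:P).

Definition eigvals n (A : 'M[R]_n) : vec R n := xget 0 (is_eigvals A).

Lemma char_poly_conjmx (K : fieldType) n (P D : 'M[K]_n) : P \in unitmx ->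
  char_poly (invmx P *m D *m P) = char_poly D.
Proof.
move=> Pu; rewrite /char_poly /char_poly_mx.
have e : map_mx (@polyC K) (invmx P) *m map_mx (@polyC K) P = 1%:M.
  by rewrite -map_mxM mulVmx// map_mx1.
rewrite (_ : _ - _ = map_mx (@polyC K) (invmx P) *m
  ('X%:M - map_mx (@polyC K) D) *m map_mx (@polyC K) P); last first.
  by rewrite mulmxBr mulmxBl scalar_mxC -!mulmxA e mulmx1 !map_mxM mulmxA.
by rewrite !det_mulmx mulrAC -det_mulmx e det1 mul1r.
Qed.

Lemma eigvalsP n (A : 'M[R]_n) : A^T = A -> is_eigvals A (eigvals A).
Proof.
move=> Asym; apply: xgetPex.
pose AC := map_mx (real_complex R) A.
have AH : AC \is hermsymmx.
  apply: realsym_hermsym.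
    apply/is_hermitianmxP; rewrite expr0 scale1r map_mx_id//.
    by rewrite /AC map_trmx Asym.
  by apply/mxOverP => i j; rewrite mxE; apply/complex_realP; exists (A i j).
have /hermitian_normalmx/orthomx_spectralP ACE := AH.
have dreal := hermitian_spectral_diag_real AH.
pose d (i : 'I_n) : R := complex.Re (spectral_diag AC 0 i).
have cA : char_poly A = \prod_i ('X - (d i)%:P).
  apply: (map_poly_inj (real_complex R)).
  rewrite map_char_poly -/AC {1}ACE char_poly_conjmx ?spectral_unit//.
  rewrite char_poly_trig ?diag_mx_is_trig// rmorph_prod/=.
  apply: eq_bigr => i _; rewrite rmorphB/= map_polyX map_polyC/= !mxE eqxx mulr1n.
  have /mxOverP/(_ 0 i)/complex_realP[k ke] := dreal.
  by rewrite /d ke.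
pose s := sort >=%O [seq d i | i <- enum 'I_n].
have szs : size s = n by rewrite size_sort size_map size_enum_ord.
exists (\col_i s`_i); split => [i j ij|].
  rewrite !mxE; apply: (@sorted_leq_nth _ >=%O) => //.
  - by move=> y x z yx zy; exact: le_trans zy yx.
  - by move=> x /=.
  - by apply: sort_sorted; exact: ge_total.
  - by rewrite inE szs.
  - by rewrite inE szs.
rewrite cA; under [RHS]eq_bigr do rewrite mxE.
have <- : \prod_(x <- s) ('X - x%:P) = \prod_(i < n) ('X - (s`_i)%:P).
  by rewrite (big_nth 0) szs big_mkord.
rewrite (perm_big [seq d i | i <- enum 'I_n]) ?perm_sort//= big_map.
by rewrite big_enum.
Qed.

(* Meant for n <= m; the n singular values are listed with multiplicities. *)
Definition singvals n m (A : 'M[R]_(n, m)) : vec R n :=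
  \col_i Num.sqrt (eigvals (A *m A^T) i 0).

Definition signed_perm_mx n (P : 'M[R]_n) := exists (e : 'rV[R]_n) (P0 : 'M[R]_n),
  [/\ forall i, e 0 i = 1 \/ e 0 i = -1, is_perm_mx P0 & P = diag_mx e *m P0].

Definition symmetric_fun n (g : vec R n -> \bar R) :=
  forall (P : 'M[R]_n) (x : vec R n), is_perm_mx P -> g (P *m x) = g x.

Definition abs_symmetric_fun n (g : vec R n -> \bar R) :=
  forall (P : 'M[R]_n) (x : vec R n), signed_perm_mx P -> g (P *m x) = g x.

End Spectra.

(* The three combinations of a matrix space with a kind of spectral function:
   [g \o sigma] on n x m matrices, [g \o sigma] on symmetric matrices and
   [g \o lambda] on symmetric matrices. *)
Variant spectral_setting :=
| RectSingular n m of (n <= m)%N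
| SymSingular of nat
| SymEigen of nat.

Definition spec_dim (s : spectral_setting) : nat :=
  match s with RectSingular n _ _ | SymSingular n | SymEigen n => n end.

Definition mspace (R : realType) (s : spectral_setting) : euclidType R :=
  match s with
  | RectSingular n m _ => emx R n m
  | SymSingular n | SymEigen n => symmx R n
  end.

Definition spectrum (R : realType) (s : spectral_setting) :
    mspace R s -> vec R (spec_dim s) :=
  match s with
  | RectSingular n m _ => fun X : emx R n m => singvals X
  | SymSingular n => fun X : symmx R n => singvals (vsval X)
  | SymEigen n => fun X : symmx R n => eigvals (vsval X)
  end.

Definition spectral_symmetry (R : realType) (s : spectral_setting) :
    (vec R (spec_dim s) -> \bar R) -> Prop :=
  match s with
  | RectSingular n _ _ | SymSingular n => @abs_symmetric_fun R n
  | SymEigen n => @symmetric_fun R n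
  end.

Record problem (R : realType) (X : euclidType R) (d e : nat) := Problem {
  pb_h : vec R d -> \bar R ;
  pb_F : {linear X -> vec R d} ;
  pb_C : X ;
  pb_theta : X -> \bar R ;
  pb_A : {linear X -> vec R e} ;
  pb_b : vec R e ;
  pb_Q : set (vec R e)
}.

Section Problem.
Context (R : realType) (X : euclidType R) (d e : nat) (p : problem X d e).

Local Notation h := (pb_h p).
Local Notation F := (pb_F p).
Local Notation C := (pb_C p).
Local Notation theta := (pb_theta p).
Local Notation A := (pb_A p).
Local Notation b := (pb_b p).
Local Notation Q := (pb_Q p).

Definition primal_obj (x : X) : \bar R :=
  (h (F x) + (dotp C x)%:E + theta x)%E.

Definition primal_feasible : set X := [set x | Q (A x - b)].

Definition primal_solutions : set X := argmin primal_obj primal_feasible.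

Definition dual_obj (yws : vec R e * vec R d * X) : \bar R :=
  let: (y, w, s) := yws in
  (eindic (dual_cone Q) y - (dotp b y)%:E + conjugate h (- w)%R
   + conjugate theta (- s)%R)%E.

Definition dual_feasible : set (vec R e * vec R d * X) :=
  [set yws | let: (y, w, s) := yws in adjoint A y + adjoint F w + s = C].

Definition dual_solutions : set (vec R e * vec R d * X) :=
  argmin dual_obj dual_feasible.

Definition grad_h : vec R d -> vec R d := gradient (fine \o h).

Definition multipliers (x : X) : set (vec R e) :=
  [set y |
    [set C - adjoint A y + adjoint F (grad_h (F x)) + v | v in subdiff theta x] 0
    /\ [set A x - b + u | u in normal_cone (dual_cone Q) y] 0].

Definition V_P (xbar : X) : set X := [set x | F x = F xbar].

Definition G1_P (xbar : X) (y : vec R e) : set X :=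
  [set x | subdiff theta x
             (adjoint A y - (adjoint F (grad_h (F xbar)) + C))].

Definition G2_P (y : vec R e) : set X :=
  [set x | [set A x - b + u | u in normal_cone (dual_cone Q) y] 0].

(* Convexity of [h] makes its domain convex.  A proper convex function is
   closed when it is lower semicontinuous. *)
Definition standing_assumptions :=
  [/\ [/\ proper_fun h, convex_efun h, open (edom h) &
          C1_on (edom h) (fine \o h)],
      [/\ proper_fun theta, convex_efun theta & lower_semicontinuous theta],
      polyhedral_cone Q,
      primal_solutions !=set0 &
      dual_solutions !=set0].

End Problem.

(* Main.v *)
Require Import Defs.
From HB Require Import structures.
From mathcomp Require Import all_boot all_order all_algebra.
From mathcomp Require Import all_classical all_reals all_analysis.
From mathcomp Require Import perm ring lra.

(** Write [V = adjoint A y - (adjoint F (grad_h (F Xbar)) + C)], where [y] is the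
    multiplier of the bounded linear regularity assumption; [V] is a subgradient
    of [theta] at [Xbar].  At a feasible [X], the objective exceeds its minimum by
    the sum of three nonnegative quantities: the Bregman distance of [h] between
    [F X] and [F Xbar], the gap [theta X - theta Xbar - dotp V (X - Xbar)], and the
    dual slack [dotp y (A X - b)].  Near [Xbar], each one is at least a multiple of
    the squared distance from [X] to one of the sets [V_P], [G1_P] and [G2_P].
    Their intersection consists of optimal solutions, so bounded linear regularity
    turns the three bounds into the growth condition ([quadratic_growth]).

    The bound by the distance to [V_P] is the strong convexity of [h] together with
    a linear error bound for [F] ([strongly_convex_gradient_le], [dist_ker_le]).
    For [G2_P], an affine function that is nonnegative on a polyhedron grows at
    least linearly away from its zeros there, which is shown by moving along the
    faces of the polyhedron ([polyhedral_error_bound]).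

    For [G1_P], metric subregularity of the subdifferential of [theta] implies
    quadratic growth: at a point [x] with small gap, take the proximal point [w]
    of [x]; it is near [x], and its subgradient is near [V], so that [w] is near a
    minimizer ([subregular_growth]).

    There remains to carry metric subregularity from [g] to [theta]
    ([subregular_lift]).  Eigenvalues and singular values are treated together, as
    a map [gamma] with an embedding [Diag] and a group of isometries under which
    every point is equivalent to [Diag] of its spectrum.  A subgradient [V'] of
    [theta] at [W] gives equality in von Neumann's trace inequality, hence a common
    decomposition [W = A (Diag (gamma W))], [V' = A (Diag (gamma V'))].  By
    subregularity for [g], the vector [gamma W] is near some [z] for which
    [gamma V] is a subgradient.  If [V'] is near [V], then [A (Diag (gamma V))] is
    a point of the orbit of [V] near [V], and a small change of [A] gives a group
    element [B] with [V = B (Diag (gamma V))] ([orthogonal_commutant]); then [V] is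
    a subgradient at [B (Diag z)], which is near [W].

    The correction is a statement on an orthogonal matrix [B] that almost commutes
    with a symmetric matrix [T]: a matrix of the commutant of [T] near [B] is almost
    orthogonal, and its polar factor stays in the commutant.
    For singular values, [T] is the symmetric dilation of [V]. *)

Set Implicit Arguments.
Unset Strict Implicit.
Unset Printing Implicit Defensive.

Import Order.TTheory GRing.Theory Num.Theory.
Import numFieldNormedType.Exports.

Local Open Scope classical_set_scope.
Local Open Scope ring_scope.

(** * Euclidean spaces *)

Section EuclideanBasics.
Context (R : realType) (E : euclidType R).
Implicit Types u v w x y : E.

Lemma dotpNr u v : dotp u (- v) = - dotp u v.
Proof. by rewrite -scaleN1r dotpZr mulN1r. Qed.

Lemma dotpNl u v : dotp (- u) v = - dotp u v.
Proof. by rewrite dotpC dotpNr dotpC. Qed.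

Lemma dotpBr u v w : dotp u (v - w) = dotp u v - dotp u w.
Proof. by rewrite dotpDr dotpNr. Qed.

Lemma dotpBl u v w : dotp (u - v) w = dotp u w - dotp v w.
Proof. by rewrite dotpDl dotpNl. Qed.

Lemma dotp0r u : dotp u 0 = 0.
Proof. by rewrite -(scale0r 0) dotpZr mul0r. Qed.

Lemma dotp0l u : dotp 0 u = 0.
Proof. by rewrite dotpC dotp0r. Qed.

Lemma sqr_normD u v : `|u + v| ^+ 2 = `|u| ^+ 2 + 2 * dotp u v + `|v| ^+ 2.
Proof. by rewrite -!dotp_norm dotpDl !dotpDr (dotpC v u); ring. Qed.

Lemma sqr_normB u v : `|u - v| ^+ 2 = `|u| ^+ 2 - 2 * dotp u v + `|v| ^+ 2.
Proof. by rewrite sqr_normD normrN dotpNr; ring. Qed.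

Lemma dotp_le u v : dotp u v <= `|u| * `|v|.
Proof.
have H : 0 <= `| `|v| *: u - `|u| *: v| ^+ 2 by exact: sqr_ge0.
move: H; rewrite sqr_normB !normrZ !normr_id dotpZl dotpZr => H.
have {}H : (`|u| * `|v|) * dotp u v <= (`|u| * `|v|) * (`|u| * `|v|) by nra.
have [u0|u0] := eqVneq u 0; first by rewrite u0 dotp0l normr0 mul0r.
have [v0|v0] := eqVneq v 0; first by rewrite v0 dotp0r normr0 mulr0.
by rewrite -(ler_pM2l (_ : 0 < `|u| * `|v|)) // mulr_gt0 ?normr_gt0.
Qed.

Lemma normr_dotp u v : `|dotp u v| <= `|u| * `|v|.
Proof.
by rewrite ler_norml dotp_le andbT lerNl -dotpNl -(normrN u) dotp_le.
Qed.

Lemma closed_ball_normP x (r : R) y : 0 < r ->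
  closed_ball x r y <-> `|y - x| <= r.
Proof. by move=> r0; rewrite closed_ballE// /closed_ball_ /= distrC. Qed.

(** Coordinate forms are inner products with fixed vectors. *)
Lemma fin_coord_bounded : exists2 c : R, 0 < c &
  forall i x, `|coord (vbasis {:E}) i x| <= c * `|x|.
Proof.
have cP (i : 'I_(\dim {:E})) :
    exists v, forall x, coord (vbasis {:E}) i x = dotp v x.
  pose f : E -> R^o := coord (vbasis {:E}) i.
  have lf : linear f by move=> a u v; rewrite /f linearP.
  pose fM := GRing.isLinear.Build R E R^o *:%R f lf.
  pose fL : {linear E -> R^o} := HB.pack f fM.
  exact: (riesz fL).
have /choice[v vP] := cP.
exists (1 + \sum_i `|v i|); first by rewrite ltr_pwDl ?ltr01 ?sumr_ge0.
move=> i x; rewrite vP; apply: le_trans (normr_dotp _ _) _.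
rewrite ler_wpM2r// (bigD1 i)//= addrCA lerDl addr_ge0//.
by rewrite sumr_ge0.
Qed.

End EuclideanBasics.

Lemma norm_dotp_eq (R : realType) (E1 E2 : euclidType R) (u : E1) (v : E2) :
  dotp u u = dotp v v -> `|u| = `|v|.
Proof.
rewrite !dotp_norm => /eqP; rewrite eqrXn2 ?normr_ge0// => /eqP.
exact.
Qed.

Section LinearMaps.
Context (R : realType) (E : euclidType R).

Lemma linear_bounded (V : normedModType R) (f : {linear E -> V}) :
  exists2 c : R, 0 < c & forall x, `|f x| <= c * `|x|.
Proof.
have [c c0 cP] := fin_coord_bounded E.
exists (1 + \sum_(i < \dim {:E}) c * `|f (vbasis {:E})`_i|).
  by rewrite ltr_pwDl ?ltr01 ?sumr_ge0// => i _; rewrite mulr_ge0 // ltW.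
move=> x; rewrite {1}(coord_vbasis (memvf x)) linear_sum /=.
apply: le_trans (ler_norm_sum _ _ _) _.
rewrite mulrDl mul1r mulr_suml -[leLHS]add0r lerD// ler_sum// => i _.
by rewrite linearZ normrZ mulrAC ler_wpM2r.
Qed.

Lemma linear_cts (V : normedModType R) (f : {linear E -> V}) : continuous f.
Proof.
have [c c0 cP] := linear_bounded f.
apply: bounded_linear_continuous; apply/linear_boundedP.
by near=> r => x; apply: le_trans (cP x) _; rewrite ler_wpM2r//.
Unshelve. all: by end_near. Qed.

End LinearMaps.

(** The distance is measured along a linear pseudo-inverse [g] of [f]: the
    point [x - g (f x)] is in the kernel, and [g] is bounded. *)
Lemma dist_ker_le (R : realType) (E E' : euclidType R) (f : {linear E -> E'}) :
  exists2 c : R, 0 < c &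
  forall x, exists2 k, f k = 0 & `|x - k| <= c * `|f x|.
Proof.
pose g : 'Hom(E', E) := ((linfun f)^-1)%VF.
have fg x : f (g (f x)) = f x.
  by have := limg_lfunVK (memv_img (linfun f) (memvf x)); rewrite !lfunE.
have [c c0 cP] := linear_bounded g.
exists c => // x; exists (x - g (f x)); first by rewrite linearB /= fg subrr.
by rewrite opprB addrCA subrr addr0; exact: cP.
Qed.


Section Compactness.
Context (R : realType) (E : euclidType R).

(** Heine-Borel, transported from row vectors along coordinates. *)
Lemma compact_euclid (K : set E) (x0 : E) (r : R) :
  closed K -> (forall x, K x -> `|x - x0| <= r) -> compact K.
Proof.
move=> Kcl Kr.
pose f (v : 'rV[R]_(\dim {:E})) : E := \sum_i v 0 i *: (vbasis {:E})`_i.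
have fc : continuous f.
  move=> v; apply: (@continuous_big _ _ (+%R : E -> E -> E)) => //=.
    exact: add_continuous.
  move=> i _ w; apply: (@cvgZr_tmp _ _ _ (nbhs w)).
  exact: coord_continuous.
have [c c0 cP] := fin_coord_bounded E.
pose K' := f @^-1` K `&`
  [set v | forall i, `[- (c * (r + `|x0|)), c * (r + `|x0|)]%classic (v 0 i)].
have fcoord x : f (\row_i coord (vbasis {:E}) i x) = x.
  rewrite {2}(coord_vbasis (memvf x)); apply: eq_bigr => i _.
  by rewrite mxE.
have K'c : compact K'.
  rewrite /K' setIC; apply: compact_closedI.
    apply: (@rV_compact R _
      (fun=> `[- (c * (r + `|x0|)), c * (r + `|x0|)]%classic)) => i.
    exact: segment_compact.
  by apply: closed_comp => // v _; exact: fc.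
have -> : K = f @` K'.
  apply/seteqP; split=> [x Kx|_ [v [/= Kv _] <-]//].
  exists (\row_i coord (vbasis {:E}) i x) => //; split; first by rewrite /= fcoord.
  move=> i /=; rewrite mxE in_itv /= -ler_norml.
  apply: le_trans (cP _ _) _; rewrite ler_wpM2l ?(ltW c0)//.
  by rewrite -[x](subrK x0) (le_trans (ler_normD _ _))// lerD2r Kr.
apply: continuous_compact => //; exact: continuous_subspaceT.
Qed.

Lemma closed_ball_compact (x : E) (r : R) : 0 < r -> compact (closed_ball x r).
Proof.
move=> r0; apply: (@compact_euclid _ x r); first exact: closed_ball_closed.
by move=> y /(closed_ball_normP _ _ r0).
Qed.

(** Without a minimizer, the sublevel sets in [K] generate a proper filter,
    and lower semicontinuity fails at its cluster points. *)
Lemma lsc_argmin (f : E -> \bar R) (K : set E) :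
  lower_semicontinuous f -> compact K -> K !=set0 ->
  exists2 x, K x & forall y, K y -> (f x <= f y)%E.
Proof.
move=> fl Kc [x0 Kx0].
apply: contrapT => no.
have noP x : K x -> exists2 y, K y & (f y < f x)%E.
  move=> Kx; apply: contrapT => no2; apply: no; exists x => // y Ky.
  by rewrite leNgt; apply/negP => yx; apply: no2; exists y.
pose F := filter_from K (fun y => [set z | K z /\ (f z <= f y)%E]).
have FF : ProperFilter F.
  apply: filter_from_proper; last by move=> y Ky; exists y => /=.
  apply: filter_from_filter; first by exists x0.
  move=> y z Ky Kz; have [fyz|fzy] := leP (f y) (f z).
    by exists y => // w /= [Kw fw]; split; split=> //; exact: le_trans fyz.
  by exists z => // w /= [Kw fw]; split; split=> //; exact: le_trans (ltW fzy).
have FK : F K by exists x0 => // z [].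
have [x [Kx xcl]] := Kc F FF FK.
have [y Ky yx] := noP x Kx.
have [z Kz zy] := noP y Ky.
have [a [fya afx]] : exists a : R, (f z < a%:E)%E /\ (a%:E < f x)%E.
  case: (f y) yx zy => [a| |] yx zy; first by exists a.
    by rewrite ltNge leey in yx.
  by rewrite ltNge leNye in zy.
have [V Vx VP] := fl x a afx.
have Fz : F [set w | K w /\ (f w <= f z)%E] by exists z.
have [w [[Kw fw] Vw]] := xcl _ _ Fz Vx.
have := VP _ Vw; apply/negP; rewrite -leNgt.
by apply: le_trans fw _; exact: ltW.
Qed.

End Compactness.

(** * Metric subregularity and quadratic growth *)

Section Distance.
Context (R : realType) (E : euclidType R).

Lemma edist_inf_le (A : set E) (x a : E) :
  A a -> (edist_inf A x <= `|x - a|%:E)%E.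
Proof.
by move=> Aa; rewrite -edist_norm; apply: ereal_inf_lbound; exists a.
Qed.

Lemma edist_inf_lt (A : set E) (x : E) (r : R) :
  (edist_inf A x < r%:E)%E -> exists2 a, A a & `|x - a| < r.
Proof.
by move=> /ereal_inf_lt[_ [a Aa <-]]; rewrite edist_norm lte_fin; exists a.
Qed.

Lemma edist_inf_fin (A : set E) (x a : E) :
  A a -> edist_inf A x \is a fin_num.
Proof.
move=> Aa; rewrite ge0_fin_numE ?edist_inf_ge0//.
by apply: le_lt_trans (edist_inf_le x Aa) _; rewrite ltry.
Qed.

End Distance.

Section Subregularity.
Context (R : realType) (E E' : euclidType R).

(** Metric subregularity in terms of points, which spares the infimum distances
    and their infinite values.  Nothing is lost: if [v] differs from [v0], a
    doubled constant leaves room for a preimage almost realizing the distance,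
    and if [v = v0], then [u] is its own witness. *)
Definition subregular_at (G : E -> set E') (u0 : E) (v0 : E') :=
  exists eps kappa : R, [/\ 0 < eps, 0 < kappa &
    forall u v, `|u - u0| <= eps -> `|v - v0| <= eps -> G u v ->
      exists2 z, G z v0 & `|u - z| <= kappa * `|v - v0|].

Lemma metrically_subregular_at (G : E -> set E') u0 v0 :
  metrically_subregular G u0 v0 -> subregular_at G u0 v0.
Proof.
move=> [_ [delta [eps [kappa [d0 e0 k0 H]]]]].
exists (Num.min delta eps), (2 * kappa).
split; [by rewrite lt_min d0|by rewrite mulr_gt0|move=> u v].
rewrite !le_min => /andP[_ ue] /andP[vd _] Guv.
have [vE|vv0] := eqVneq v v0.
  by rewrite vE in Guv *; exists u; rewrite // !subrr !normr0 mulr0.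
have nv : 0 < `|v - v0| by rewrite normr_gt0 subr_eq0.
have /edist_inf_lt[z Gz uz] :
    (edist_inf [set u' | G u' v0] u < (2 * kappa * `|v - v0|)%:E)%E.
  apply: le_lt_trans (H u _) _; first exact/closed_ball_normP.
  apply: (@le_lt_trans _ _ (kappa%:E * `|v0 - v|%:E)%E).
    rewrite lee_pmul2l ?lte_fin// ; last first.
    apply: edist_inf_le; split=> //; exact/closed_ball_normP.
  by rewrite -EFinM lte_fin distrC -mulrA ltr_pMl ?mulr_gt0// ltr1n.
by exists z => //; exact: ltW.
Qed.

End Subregularity.

Section Growth.
Context (R : realType) (E : euclidType R).
Implicit Types (f : E -> \bar R) (x v w y : E).

Lemma lsc_addr f (c : E -> R) : continuous c -> lower_semicontinuous f ->
  lower_semicontinuous (fun x => f x + (c x)%:E)%E.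
Proof.
move=> cc fl x a afx.
have [b [bf ab]] : exists b : R, (b%:E < f x)%E /\ a < b + c x.
  case: (f x) afx => [r| |] //= h.
    rewrite -EFinD lte_fin in h; exists (r - (r + c x - a) / 2).
    by rewrite lte_fin; split; lra.
  by exists (a - c x + 1); rewrite ltry; split=> //; lra.
have [V Vx VP] := fl _ _ bf.
have e0 : 0 < b + c x - a by rewrite subr_gt0.
exists (V `&` [set y | `|c x - c y| < b + c x - a]).
  by apply: filterI => //; have /cvgrPdist_lt := cc x; exact.
move=> y [/VP bfy /= cy]; have {}cy := le_lt_trans (ler_norm _) cy.
apply: (@lt_trans _ _ (b%:E + (c y)%:E)%E).
  by rewrite -EFinD lte_fin; lra.
by rewrite lteD2rE.
Qed.

Lemma norm_dotp_cts x v (a : R) :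
  continuous (fun y => a * `|y - x| ^+ 2 - dotp v (y - x)).
Proof.
have dc : continuous (fun y => dotp v (y - x) : R^o).
  have h := @linear_cts _ _ R^o (dotp v).
  move=> y; apply: (@continuous_comp _ _ _ (fun y => y - x) (dotp v)); last exact: h.
  apply: cvgB; [exact: cvg_id|exact: cvg_cst].
move=> y; apply: cvgB; last exact: dc.
apply: cvgM; first exact: cvg_cst.
rewrite /GRing.exp /=.
have nc : `|z - x| @[z --> y] --> `|y - x|.
  by apply: cvg_norm; apply: cvgB; [exact: cvg_id|exact: cvg_cst].
by apply: cvgM.
Qed.

Lemma subdiff_fin f x v : proper_fun f -> subdiff f x v -> f x \is a fin_num.
Proof.
move=> [fNy [y]] /= fy fv; rewrite fin_numElt fNy /=.
have := le_lt_trans (fv y) fy.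
by case: (f x) (fNy x) => // r; rewrite ltry.
Qed.

(** First-order condition at a proximal point [w]: compare [w] with the points
    [w + t (y - w)], where convexity bounds [f] by its chord; the second-order
    term [t ^+ 2 * q] disappears after division by [t]. *)
Lemma prox_subdiff f x v w : proper_fun f -> convex_efun f ->
  f w \is a fin_num ->
  (forall y, f w + (2^-1 * `|w - x| ^+ 2 - dotp v (w - x))%:E
     <= f y + (2^-1 * `|y - x| ^+ 2 - dotp v (y - x))%:E)%E ->
  subdiff f w (v - (w - x)).
Proof.
move=> [fNy _] fc; case fwE : (f w) => [a| |] // _ H y.
have := fNy y; case fyE : (f y) => [b| |] // _; last by rewrite fwE leey.
rewrite fwE -EFinD lee_fin.
apply/ler_addgt0Pr => e e0.
pose q := 2^-1 * `|y - w| ^+ 2.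
have q0 : 0 <= q by rewrite mulr_ge0 ?sqr_ge0// invr_ge0.
(* an error [e] replaces the passage to the limit in [t] *)
have [t [t0 t1 tq]] : exists t : R, [/\ 0 < t, t <= 1 & t * q <= e].
  exists (e / (e + q)); split; first by rewrite divr_gt0 ?ltr_pwDl.
    by rewrite ler_pdivrMr ?ltr_pwDl// mul1r lerDl.
  rewrite mulrAC ler_pdivrMr ?ltr_pwDl//; nra.
have := H (t *: y + (1 - t) *: w).
have yE : t *: y + (1 - t) *: w - x = (w - x) + t *: (y - w).
  by rewrite scalerBl scale1r scalerBr addrCA addrAC.
rewrite yE (sqr_normD (w - x)) (dotpDr v (w - x)) normrZ !dotpZr exprMn.
rewrite real_normK ?num_real//.
have ct : 0 <= t <= 1 by rewrite (ltW t0).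
have := fc y w t ct; rewrite fyE fwE -!EFinM -EFinD => fct H2.
have {H2 fct} := le_trans H2 (leeD2r _ fct).
rewrite -!EFinD lee_fin (dotpBl v) => H2.
set s := dotp (w - x) (y - w) in H2 *; set z := dotp v (y - w) in H2 *.
rewrite -(ler_pM2l t0).
have : t * (t * q) <= t * e by rewrite ler_pM2l.
rewrite /q; move: H2; set n1 := `|w - x| ^+ 2; set n2 := `|y - w| ^+ 2.
nra.
Qed.

(** The affine minorant given by the subgradient [v] makes the proximal
    objective at least [f x] outside a ball around [x], so a minimizer over the
    ball is global; the same minorant bounds its distance to [x]. *)
Lemma prox_exists f x0 v x (a gap : R) : proper_fun f -> convex_efun f ->
  lower_semicontinuous f -> subdiff f x0 v -> f x0 = a%:E ->
  f x = (a + dotp v (x - x0) + gap)%:E ->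
  exists2 w, subdiff f w (v - (w - x)) & `|w - x| ^+ 2 <= 2 * gap.
Proof.
move=> fp fc fl fv fx0 fx.
pose F y := (f y + (2^-1 * `|y - x| ^+ 2 - dotp v (y - x))%:E)%E.
have Fl : lower_semicontinuous F by apply: lsc_addr => //; exact: norm_dotp_cts.
have Fge y : ((a + dotp v (x - x0) + 2^-1 * `|y - x| ^+ 2)%:E <= F y)%E.
  apply: le_trans (leeD2r _ (fv y)); rewrite fx0 -!EFinD lee_fin !dotpBr; lra.
have Fx : F x = f x by rewrite /F subrr normr0 expr0n /= dotp0r mulr0 subrr adde0.
have gap0 : 0 <= gap.
  have := Fge x; rewrite Fx fx lee_fin subrr normr0 expr0n /= mulr0; lra.
pose r := 1 + 2 * gap.
have r0 : 0 < r by rewrite /r; lra.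
have [|w wr wmin] := lsc_argmin Fl (@closed_ball_compact _ _ x r r0).
  by exists x; apply/closed_ball_normP => //; rewrite subrr normr0 ltW.
have Fwx : (F w <= F x)%E.
  by apply: wmin; apply/closed_ball_normP => //; rewrite subrr normr0 ltW.
have wgap : `|w - x| ^+ 2 <= 2 * gap.
  have := le_trans (Fge w) Fwx; rewrite Fx fx lee_fin; lra.
exists w => //; apply: prox_subdiff => //.
  rewrite fin_numElt fp.1 /=; move: Fwx; rewrite Fx fx /F.
  by case: (f w) => // r1 _; rewrite ltry.
move=> y; change (F w <= F y)%E.
have [yr|yr] := leP `|y - x| r; first by apply/wmin/closed_ball_normP.
apply: le_trans Fwx _; apply: le_trans (Fge y); rewrite Fx fx lee_fin lerD2l.
have : r ^+ 2 <= `|y - x| ^+ 2 by rewrite lerXn2r ?nnegrE// ltW.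
rewrite /r; nra.
Qed.

(** The proximal point [w] of [x] is within the square root of twice the gap, and
    [v + (x - w)] is a subgradient at [w], so subregularity puts [w], hence [x],
    within a multiple of that distance of a minimizer.  If the gap is too large
    for [w] to be near [x0], then [x0] itself is a suitable minimizer. *)
Lemma subregular_growth f x0 v : proper_fun f -> convex_efun f ->
  lower_semicontinuous f -> subdiff f x0 v -> subregular_at (subdiff f) x0 v ->
  exists delta kappa : R, [/\ 0 < delta, 0 < kappa &
    forall x, `|x - x0| <= delta -> exists2 z, subdiff f z v &
      (f x0 + (dotp v (x - x0) + kappa * `|x - z| ^+ 2)%:E <= f x)%E].
Proof.
move=> fp fc fl fv [eps [k [e0 k0 H]]].
case fx0 : (f x0) (subdiff_fin fp fv) => [a| |] // _.
pose kappa := Num.min (2^-1 / (1 + k) ^+ 2) 2^-1.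
have k1 : 0 < (1 + k) ^+ 2 by rewrite exprn_gt0//; lra.
have kap0 : 0 < kappa by rewrite lt_min invr_gt0 divr_gt0 ?invr_gt0 ?ltr0n.
exists (eps / 2), kappa; split; rewrite ?divr_gt0// => x xx0.
have := fp.1 x; case fx : (f x) => [b| |] // _; last first.
  by exists x0 => //; rewrite leey.
pose gap := b - a - dotp v (x - x0).
have bE : b = a + dotp v (x - x0) + gap by rewrite /gap; ring.
have gap0 : 0 <= gap.
  have := fv x; rewrite fx0 fx -EFinD lee_fin bE; lra.
have [w wv wx] := prox_exists fp fc fl fv fx0 (etrans fx (congr1 EFin bE)).
have [small|big] := leP (2 * gap) ((eps / 2) ^+ 2); last first.
  exists x0 => //; rewrite -EFinD lee_fin bE addrA lerD2l.
  apply: (@le_trans _ _ (2^-1 * (eps / 2) ^+ 2)); last by lra.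
  apply: ler_pM; rewrite ?sqr_ge0 ?(ltW kap0)//; first by rewrite ge_min lexx orbT.
  by rewrite lerXn2r ?nnegrE// divr_ge0 ?(ltW e0).
have nwx : `|w - x| <= eps / 2.
  by rewrite -ler_sqr ?nnegrE ?divr_ge0 ?(ltW e0)//; exact: le_trans small.
have [||z zv wz] := H w (v - (w - x)) _ _ wv.
- rewrite (_ : w - x0 = (w - x) + (x - x0)); last by rewrite addrA subrK.
  by apply: le_trans (ler_normD _ _) _; lra.
- by rewrite addrAC subrr sub0r normrN; lra.
exists z => //; rewrite -EFinD lee_fin bE addrA lerD2l.
have xz : `|x - z| <= (1 + k) * `|w - x|.
  rewrite (_ : x - z = (x - w) + (w - z)); last by rewrite addrA subrK.
  apply: le_trans (ler_normD _ _) _; rewrite distrC mulrDl mul1r lerD2l.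
  by move: wz; rewrite addrAC subrr sub0r normrN.
apply: (@le_trans _ _ (2^-1 / (1 + k) ^+ 2 * ((1 + k) * `|w - x|) ^+ 2)).
  apply: ler_pM; rewrite ?sqr_ge0 ?(ltW kap0)//; first by rewrite ge_min lexx.
  by rewrite lerXn2r ?nnegrE// mulr_ge0//; lra.
rewrite exprMn mulrA divfK ?gt_eqF//; lra.
Qed.

End Growth.

(** * Spectral decomposition systems *)

(** The common features of eigenvalues and singular values (a normal
    decomposition system in the sense of Lewis, with one more axiom).
    [es_trace] is von Neumann's trace inequality; [es_orbit] says that a group
    element moving [v] a little is close to the stabilizer of [v]; it stands
    for the perturbation theory of eigenvectors and singular vectors. *)
Record spectral_system (R : realType) (E : euclidType R) (n : nat)
    (gamma : E -> vec R n) (Diag : {linear vec R n -> E})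
    (G : set (E -> E)) : Prop := SpectralSystem {
  es_linear : forall A, G A -> linear A ;
  es_isometry : forall A u v, G A -> dotp (A u) (A v) = dotp u v ;
  es_comp : forall A B, G A -> G B -> G (A \o B) ;
  es_inv : forall A, G A -> exists2 B, G B & cancel B A ;
  es_diag : forall u v, dotp (Diag u) (Diag v) = dotp u v ;
  es_dec : forall x, exists2 A, G A & x = A (Diag (gamma x)) ;
  es_gamma : forall A x, G A -> gamma (A (Diag (gamma x))) = gamma x ;
  es_trace : forall x y, dotp x y <= dotp (gamma x) (gamma y) ;
  es_orbit : forall v, exists2 c : R, 0 < c & forall A, G A ->
    exists2 B, G B & B v = v /\ forall x, `|A x - B x| <= c * `|A v - v| * `|x|
}.

Section SpectralSystem.
Context (R : realType) (E : euclidType R) (n : nat) (gamma : E -> vec R n).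
Context (Diag : {linear vec R n -> E}) (G : set (E -> E)).
Hypothesis sys : spectral_system gamma Diag G.

Lemma es_subr A u v : G A -> A u - A v = A (u - v).
Proof.
move=> GA; have := es_linear sys GA (-1) v u.
by rewrite !scaleN1r addrC => <-; rewrite addrC.
Qed.

Lemma es_addr A u v : G A -> A (u + v) = A u + A v.
Proof. by move=> GA; have := es_linear sys GA 1 u v; rewrite !scale1r. Qed.

Lemma es_norm A u : G A -> `|A u| = `|u|.
Proof. by move=> GA; apply: norm_dotp_eq; rewrite (es_isometry sys). Qed.

Lemma diag_norm u : `|Diag u| = `|u|.
Proof. by apply: norm_dotp_eq; rewrite (es_diag sys). Qed.

Lemma gamma_norm x : `|gamma x| = `|x|.
Proof.
by have [A GA {2}->] := es_dec sys x; rewrite es_norm// diag_norm.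
Qed.

Lemma gamma_lip x y : `|gamma x - gamma y| <= `|x - y|.
Proof.
rewrite -ler_sqr ?nnegrE// !sqr_normB !gamma_norm.
by rewrite lerD2r lerD2l lerN2 ler_pM2l// (es_trace sys).
Qed.

(** Decompose [x + y] by [A]; then [gamma (x + y) = gamma x + gamma y] by the
    equality case of Cauchy-Schwarz.  The defect [f z u] below is linear in [u]
    and nonnegative at the spectra, so it vanishes at [gamma x] and [gamma y]
    because it does at their sum. *)
Lemma simultaneous_decomposition x y :
  dotp x y = dotp (gamma x) (gamma y) ->
  exists2 A, G A & x = A (Diag (gamma x)) /\ y = A (Diag (gamma y)).
Proof.
move=> xy; have [A GA sE] := es_dec sys (x + y); exists A => //.
pose f z u := dotp (gamma z) u - dotp z (A (Diag u)).
have f0 z w : 0 <= f z (gamma w).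
  by rewrite subr_ge0 -{2}(es_gamma sys w GA) (es_trace sys).
have fD z u v : f z (u + v) = f z u + f z v.
  by rewrite /f (linearD Diag) es_addr// !dotpDr; ring.
have fz z : f z (gamma z) = 0 -> z = A (Diag (gamma z)).
  move=> H; apply/eqP; rewrite -subr_eq0 -normr_eq0 -sqrf_eq0 sqr_normB.
  rewrite es_norm// diag_norm.
  move: H; rewrite /f dotp_norm gamma_norm => H; apply/eqP; lra.
have nn : `|gamma x + gamma y| ^+ 2 = `|x + y| ^+ 2.
  by rewrite !sqr_normD !gamma_norm xy.
have fs : f x (gamma (x + y)) + f y (gamma (x + y)) =
    dotp (gamma x + gamma y) (gamma (x + y)) - `|x + y| ^+ 2.
  by rewrite -dotp_norm {5}sE /f !dotpDl; ring.
have cs := dotp_le (gamma x + gamma y) (gamma (x + y)).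
have {}nn' : `|gamma x + gamma y| = `|x + y|.
  by apply/eqP; rewrite -(@eqrXn2 _ 2)// nn.
rewrite nn' gamma_norm -expr2 in cs.
have gs : gamma (x + y) = gamma x + gamma y.
  apply/eqP; rewrite -subr_eq0 -normr_eq0 -sqrf_eq0 sqr_normB nn gamma_norm.
  have := f0 x (x + y); have := f0 y (x + y).
  rewrite [dotp (gamma (x + y)) _]dotpC => h1 h2; apply/eqP/le_anti/andP.
  split; first by lra.
  by have := sqr_ge0 (`|gamma (x + y) - (gamma x + gamma y)|);
    rewrite sqr_normB nn gamma_norm [dotp (gamma (x + y)) _]dotpC.
have fx := f0 x x; have fxy := f0 x y; have fyx := f0 y x; have fy := f0 y y.
move: fs; rewrite gs !fD -gs dotp_norm gamma_norm => fs.
by split; apply: fz; apply: le_anti; apply/andP; split=> //; lra.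
Qed.

Context (g : vec R n -> \bar R).
Hypothesis gp : proper_fun g.
Hypothesis gG : forall A u, G A -> g (gamma (A (Diag u))) = g u.

Let theta x := g (gamma x).

Lemma spectral_proper : proper_fun theta.
Proof.
split=> [x|]; first exact: gp.1.
have [A GA _] := es_dec sys 0; have [u gu] := gp.2.
by exists (A (Diag u)); rewrite /edom /= /theta gG.
Qed.

(** Test the subgradient inequality at [A (Diag u)], where [A] decomposes [v];
    with [u = gamma w] it forces equality in the trace inequality. *)
Lemma subdiff_spectral w v : subdiff theta w v ->
  subdiff g (gamma w) (gamma v) /\ dotp v w = dotp (gamma v) (gamma w).
Proof.
move=> wv; have [A GA vE] := es_dec sys v.
have key u : (g (gamma w) + (dotp (gamma v) u - dotp v w)%:E <= g u)%E.
  have := wv (A (Diag u)); rewrite /theta gG// dotpBr.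
  by rewrite {1}vE (es_isometry sys)// (es_diag sys).
have vw : dotp v w = dotp (gamma v) (gamma w).
  apply/le_anti; rewrite (es_trace sys)/=.
  have := key (gamma w).
  have := subdiff_fin spectral_proper wv; rewrite /theta.
  by case: (g (gamma w)) => // r _; rewrite -EFinD lee_fin; lra.
by split=> // u; rewrite dotpBr -vw; exact: key.
Qed.

Lemma subdiff_lift A v z : G A -> v = A (Diag (gamma v)) ->
  subdiff g z (gamma v) -> subdiff theta (A (Diag z)) v.
Proof.
move=> GA vE gz y; rewrite /theta gG//.
apply: le_trans (gz (gamma y)); apply: leeD2l.
rewrite lee_fin !dotpBr lerB ?(es_trace sys)//.
by rewrite {2}vE (es_isometry sys)// (es_diag sys).
Qed.

(** Decompose [w] and [v'] simultaneously by [A], move the spectrum of [w] into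
    the solution set of [g], and replace [A] by a nearby group element that
    decomposes [v] exactly. *)
Lemma subregular_lift x0 v :
  subregular_at (subdiff g) (gamma x0) (gamma v) ->
  subregular_at (subdiff theta) x0 v.
Proof.
move=> [eps [k [e0 k0 H]]].
have [c c0 orb] := es_orbit sys v.
have [A0 GA0 vE] := es_dec sys v.
pose M := `|x0| + eps + k * eps.
have M0 : 0 <= M by rewrite !addr_ge0 ?mulr_ge0 ?(ltW e0) ?(ltW k0).
exists eps, (k + c * 2 * M); split=> //.
  by rewrite ltr_wpDr// !mulr_ge0// ltW.
move=> w v' wx vv wv.
have [gwv tr] := subdiff_spectral wv.
have [z gz wz] := H _ _ (le_trans (gamma_lip _ _) wx) (le_trans (gamma_lip _ _) vv) gwv.
have [A GA [v'E wE]] := simultaneous_decomposition tr.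
have [A1 GA1 A1K] := es_inv sys GA0.
have GC : G (A \o A1) by exact: (es_comp sys).
have A1v : A1 v = Diag (gamma v).
  apply/eqP; rewrite -subr_eq0 -normr_eq0 -(es_norm _ GA0) -es_subr// A1K -vE.
  by rewrite subrr normr0.
have Cv : (A \o A1) v = A (Diag (gamma v)) by rewrite /= A1v.
have [B GB [Bv AB]] := orb _ GC.
exists (B (A0 (Diag z))).
  apply: (@subdiff_lift (B \o A0)) => //; first exact: (es_comp sys).
  by rewrite /= -vE Bv.
have A1Diag u : (A \o A1) (A0 (Diag u)) = A (Diag u).
  rewrite /=; congr (A _); apply/eqP; rewrite -subr_eq0 -normr_eq0.
  by rewrite -(es_norm _ GA0) -es_subr// A1K subrr normr0.
have nv : `|(A \o A1) v - v| <= 2 * `|v' - v|.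
  rewrite Cv -(subrK v' (A (Diag (gamma v)))) -addrA.
  apply: le_trans (ler_normD _ _) _.
  rewrite {1}v'E es_subr// es_norm// -linearB diag_norm mulrDl mul1r lerD2r.
  by rewrite [leRHS]distrC gamma_lip.
have nz : `|z| <= M.
  rewrite -(subrK (gamma w) z); apply: le_trans (ler_normD _ _) _.
  rewrite gamma_norm distrC addrC lerD//.
    by rewrite -(subrK x0 w) (le_trans (ler_normD _ _))// addrC lerD2l.
  apply: le_trans wz _; rewrite ler_pM2l//.
  exact: le_trans (gamma_lip _ _) vv.
rewrite -(subrK (A (Diag z)) w) -addrA mulrDl.
apply: le_trans (ler_normD _ _) _; apply: lerD.
  rewrite {1}wE es_subr// es_norm// -linearB diag_norm.
  apply: le_trans wz _; rewrite ler_pM2l//; exact: gamma_lip.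
rewrite -A1Diag; apply: le_trans (AB _) _.
rewrite (es_norm (Diag z) GA0) diag_norm -!mulrA ler_pM2l//.
by rewrite [leRHS]mulrCA [leRHS]mulrC ler_pM.
Qed.

End SpectralSystem.

(** * Orthogonal diagonalization *)

Definition orthogonal (R : realType) n (U : 'M[R]_n) := U^T *m U = 1%:M.

Section Orthogonal.
Context (R : realType).

Lemma orthogonalr n (U : 'M[R]_n) : orthogonal U -> U *m U^T = 1%:M.
Proof. exact: mulmx1C. Qed.

Lemma orthogonal1 n : orthogonal (1%:M : 'M[R]_n).
Proof. by rewrite /orthogonal trmx1 mulmx1. Qed.

Lemma orthogonalT n (U : 'M[R]_n) : orthogonal U -> orthogonal U^T.
Proof. by move=> oU; rewrite /orthogonal trmxK orthogonalr. Qed.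

Lemma orthogonalM n (U V : 'M[R]_n) :
  orthogonal U -> orthogonal V -> orthogonal (U *m V).
Proof.
move=> oU oV; rewrite /orthogonal trmx_mul -mulmxA (mulmxA U^T) oU mul1mx.
exact: oV.
Qed.

Lemma orthogonalK n m (U : 'M[R]_n) (X : 'M[R]_(n, m)) :
  orthogonal U -> U^T *m (U *m X) = X.
Proof. by move=> oU; rewrite mulmxA oU mul1mx. Qed.

Lemma orthogonalKr n m (U : 'M[R]_n) (X : 'M[R]_(n, m)) :
  orthogonal U -> U *m (U^T *m X) = X.
Proof. by move=> /orthogonalr oU; rewrite mulmxA oU mul1mx. Qed.

Lemma orthogonal_block n m (U : 'M[R]_n) (V : 'M[R]_m) :
  orthogonal U -> orthogonal V -> orthogonal (block_mx U 0 0 V).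
Proof.
rewrite /orthogonal => oU oV; rewrite tr_block_mx !trmx0 mulmx_block oU oV.
by rewrite !mulmx0 !mul0mx !addr0 add0r -scalar_mx_block.
Qed.

Lemma mx11_sqr_ge0 n (u : 'cV[R]_n) : 0 <= (u^T *m u) 0 0.
Proof.
by rewrite mxE sumr_ge0 // => i _; rewrite mxE -expr2 sqr_ge0.
Qed.

Lemma mx11_sqr_eq0 n (u : 'cV[R]_n) : (u^T *m u) 0 0 = 0 -> u = 0.
Proof.
rewrite mxE => /eqP; rewrite psumr_eq0 => [/allP H|i _]; last first.
  by rewrite mxE -expr2 sqr_ge0.
apply/colP => i; have := H i (mem_index_enum i).
by rewrite /= !mxE -expr2 sqrf_eq0 => /eqP.
Qed.

Lemma normalize_col n (v : 'cV[R]_n) : v != 0 ->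
  exists2 a, a != 0 & (a *: v)^T *m (a *: v) = 1%:M.
Proof.
set s := (v^T *m v) 0 0; have vv : v^T *m v = s%:M by exact: mx11_scalar.
move=> v0; have s0 : 0 < s.
  rewrite lt_neqAle mx11_sqr_ge0 andbT eq_sym.
  by apply: contra v0 => /eqP/mx11_sqr_eq0 ->.
exists (Num.sqrt s)^-1; first by rewrite invr_eq0 sqrtr_eq0 -ltNge.
rewrite [(_ *: v)^T]linearZ/= -scalemxAl -scalemxAr scalerA vv.
by rewrite scale_scalar_mx -invfM -expr2 sqr_sqrtr ?(ltW s0)// mulVf// gt_eqF.
Qed.

(** The Householder reflection exchanging the first basis vector and [u]. *)
Lemma orthogonal_first_col n (u : 'cV[R]_(1 + n)) : u^T *m u = 1%:M ->
  exists2 H : 'M[R]_(1 + n), orthogonal H & H *m delta_mx 0 0 = u.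
Proof.
move=> uu; pose e : 'cV[R]_(1 + n) := delta_mx 0 0; pose w := u - e.
have [/eqP|w0] := eqVneq w 0.
  rewrite subr_eq0 => /eqP ->; exists 1%:M; rewrite ?mul1mx//.
  exact: orthogonal1.
have ee : e^T *m e = 1%:M.
  by rewrite trmx_delta mul_delta_mx; apply/matrixP => i j; rewrite !ord1 !mxE.
pose c : R := (e^T *m u) 0 0.
have eu : e^T *m u = c%:M by rewrite [LHS]mx11_scalar.
have ue : u^T *m e = c%:M by rewrite -[LHS]trmxK trmx_mul trmxK eu tr_scalar_mx.
have ww : w^T *m w = (2 * (1 - c))%:M.
  rewrite /w [(_ - _)^T]linearB/= mulmxBl !mulmxBr uu ue eu ee.
  by apply/matrixP => i j; rewrite !ord1 !mxE/=; ring.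
have c1 : 1 - c != 0.
  apply: contra w0 => /eqP c1; apply/eqP/mx11_sqr_eq0.
  by rewrite ww c1 mulr0 mxE.
have we : w^T *m e = (c - 1)%:M.
  rewrite /w [(_ - _)^T]linearB/= mulmxBl ue ee.
  by apply/matrixP => i j; rewrite !ord1 !mxE/=; ring.
pose H := 1%:M - (1 - c)^-1 *: (w *m w^T).
have HT : H^T = H.
  by rewrite /H linearB/= [(_ *: _)^T]linearZ/= trmx_mul trmxK trmx1.
exists H.
  rewrite /orthogonal HT /H mulmxBl mul1mx mulmxBr mulmx1 -scalemxAl.
  rewrite -scalemxAr -mulmxA (mulmxA w^T) ww mul_scalar_mx -scalemxAr !scalerA.
  rewrite -[X in _ - (X - _)]scale1r.
  have -> : (1 - c)^-1 * ((1 - c)^-1 * (2 * (1 - c))) = 2 * (1 - c)^-1.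
    by field.
  rewrite scale1r opprB addrA -[RHS]addr0 -!addrA; congr (_ + _).
  move: (w *m w^T) => Y; apply/matrixP => i j; rewrite !mxE; field.
  exact: c1.
rewrite /H mulmxBl mul1mx -scalemxAl -mulmxA we -/e mul_mx_scalar scalerA.
have -> : (1 - c)^-1 * (c - 1) = -1 by field; exact: c1.
by rewrite scaleN1r opprK /w addrCA subrr addr0.
Qed.

Lemma real_eigenvector n (A : 'M[R]_n.+1) : A^T = A ->
  exists (r : R) (u : 'cV[R]_n.+1), u^T *m u = 1%:M /\ A *m u = r *: u.
Proof.
move=> AT; have [_ cA] := eigvalsP AT.
set r := eigvals A ord0 0 in cA.
have /eigenvalueP[v vA v0] : eigenvalue A r.
  rewrite eigenvalue_root_char cA rootE horner_prod.
  by rewrite (bigD1 ord0)//= hornerXsubC subrr mul0r.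
have vT0 : v^T != 0.
  by apply: contra v0 => /eqP/(congr1 trmx); rewrite trmxK trmx0 => ->.
have [a a0 aa] := normalize_col vT0.
exists r, (a *: v^T); split=> //.
rewrite -scalemxAr -[A in A *m _]AT -trmx_mul vA linearZ/= scalerA mulrC.
by rewrite scalerA.
Qed.

Lemma block_first_rowcol n m (X : 'M[R]_(1 + n, 1 + m)) (r : R) :
  X *m delta_mx 0 0 = r *: (delta_mx 0 0 : 'cV_(1 + n)) ->
  X^T *m delta_mx 0 0 = r *: (delta_mx 0 0 : 'cV_(1 + m)) ->
  X = block_mx r%:M 0 0 (drsubmx X).
Proof.
move=> Xc Xr.
have Xi0 i : X i 0 = r * (i == 0)%:R.
  have := congr1 (fun M : 'cV_(1 + n) => M i 0) Xc.
  by rewrite -colE !mxE eqxx andbT.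
have X0j j : X 0 j = r * (j == 0)%:R.
  have := congr1 (fun M : 'cV_(1 + m) => M j 0) Xr.
  by rewrite -colE !mxE eqxx andbT.
have l0 k : lshift k (0 : 'I_1) = 0 :> 'I_(1 + k) by exact/val_inj.
rewrite -[LHS]submxK; congr block_mx; apply/matrixP => i j; rewrite !mxE.
- by rewrite !ord1 !l0 Xi0 eqxx mulr1.
- by rewrite !ord1 !l0 X0j mulr0.
- by rewrite !ord1 !l0 Xi0 mulr0.
Qed.

Lemma deflated_conj n m (U : 'M[R]_n) (W : 'M[R]_m) (r : R) (D : 'M[R]_(n, m)) :
  block_mx 1%:M 0 0 U *m block_mx r%:M 0 0 D *m
    (block_mx 1%:M 0 0 W : 'M[R]_(1 + m))^T =
  block_mx r%:M 0 0 (U *m D *m W^T) :> 'M[R]_(1 + n, 1 + m).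
Proof.
rewrite tr_block_mx trmx1 !trmx0.
by rewrite !mulmx_block !(mulmx0, mul0mx, mulmx1, mul1mx, addr0, add0r).
Qed.

(** Deflation: a reflection carries a unit eigenvector to the first axis. *)
Lemma real_spectral n (A : 'M[R]_n) : A^T = A ->
  exists (U : 'M[R]_n) (d : 'cV[R]_n), orthogonal U /\
    A = U *m diag_mx d^T *m U^T.
Proof.
elim: n A => [|n IHn] A AT.
  by exists 1%:M, 0; split; [exact: orthogonal1|apply/matrixP => -[]].
have [r [u [uu Au]]] := real_eigenvector AT.
have [H oH He] := orthogonal_first_col uu.
pose A' : 'M[R]_(1 + n) := H^T *m A *m H.
have A'T : A'^T = A' by rewrite /A' !trmx_mul trmxK AT mulmxA.
have A'e : A' *m delta_mx 0 0 = r *: (delta_mx 0 0 : 'cV_(1 + n)).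
  by rewrite /A' -!mulmxA He Au -scalemxAr -He orthogonalK.
have A'E : A' = block_mx r%:M 0 0 (drsubmx A').
  by apply: block_first_rowcol; rewrite ?A'T.
have [U2 [d2 [oU2 E2]]] := IHn (drsubmx A')
  (etrans (trmx_drsub A') (congr1 drsubmx A'T)).
pose U : 'M[R]_(1 + n) := H *m block_mx 1%:M 0 0 U2.
exists U, (col_mx r%:M d2); split.
  by apply: orthogonalM => //; apply: (@orthogonal_block 1 _) => //; exact: orthogonal1.
have -> : A = H *m A' *m H^T.
  by rewrite /A' -!mulmxA orthogonalr// mulmx1 orthogonalKr.
clearbody A'.
rewrite /U trmx_mul -!mulmxA; congr (_ *m _); rewrite !mulmxA; congr (_ *m _).
have -> : diag_mx (col_mx r%:M d2)^T = block_mx r%:M 0 0 (diag_mx d2^T) :> 'M[R]_(1 + n).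
  rewrite tr_col_mx tr_scalar_mx diag_mx_row.
  by congr block_mx; apply/matrixP => i j; rewrite !ord1 !mxE.
rewrite {1}A'E E2; symmetry; exact: deflated_conj.
Qed.

Definition rect_diag n m (d : 'cV[R]_n) : 'M[R]_(n, m) :=
  \matrix_(i, j) (d i 0 *+ (i == j :> nat)).

(** Deflation by a pair of singular vectors.  For the eigenvalue 0 of
    [X *m X^T], the matching right singular vector is any unit vector in the
    kernel of [X], which is nontrivial because [X] has deficient row rank. *)
Lemma real_svd n m (X : 'M[R]_(n, m)) : (n <= m)%N ->
  exists (U : 'M[R]_n) (W : 'M[R]_m) (d : 'cV[R]_n),
    [/\ orthogonal U, orthogonal W & X = U *m rect_diag m d *m W^T].
Proof.
elim: n m X => [|n IHn] [//|m] X nm.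
- exists 1%:M, 1%:M, 0; split; try exact: orthogonal1.
  by apply/matrixP => -[].
- exists 1%:M, 1%:M, 0; split; try exact: orthogonal1.
  by apply/matrixP => -[].
have [r [u [uu Xu]]] : exists (r : R) (u : 'cV[R]_n.+1),
    u^T *m u = 1%:M /\ X *m X^T *m u = r *: u.
  by apply: real_eigenvector; rewrite trmx_mul trmxK.
have rE : (X^T *m u)^T *m (X^T *m u) = r%:M.
  rewrite trmx_mul trmxK -mulmxA (mulmxA X) Xu -scalemxAr uu.
  by rewrite scale_scalar_mx mulr1.
have [s [w [ww Xw XTu]]] : exists (s : R) (w : 'cV[R]_m.+1),
    [/\ w^T *m w = 1%:M, X *m w = s *: u & X^T *m u = s *: w].
  have [v0|v0] := eqVneq (X^T *m u) 0; last first.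
    have [a a0 aa] := normalize_col v0.
    exists a^-1, (a *: (X^T *m u)); split=> //; last first.
      by rewrite scalerA mulVf// scale1r.
    rewrite -scalemxAr mulmxA Xu scalerA; congr (_ *: _).
    have := congr1 (fun M : 'M[R]_1 => M 0 0) aa.
    rewrite [(_ *: _)^T]linearZ/= -scalemxAl -scalemxAr scalerA rE !mxE /= !mulr1n => ar.
    by apply: (mulfI a0); rewrite mulrA ar mulfV.
  have : \rank X^T != m.+1.
    rewrite mxrank_tr; apply/negP => /eqP rX.
    have /row_freeP[Y XY] : row_free X.
      by rewrite /row_free eqn_leq rank_leq_row rX nm.
    have /matrixP/(_ 0 0) : u^T *m u = 0.
      rewrite -[X in X *m _]mulmx1 -XY mulmxA -(trmxK X) -trmx_mul v0 trmx0.
      by rewrite !mul0mx.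
    by rewrite uu !mxE => /eqP; rewrite oner_eq0.
  have := rank_leq_row X^T; rewrite leq_eqVlt => /orP[-> //|rX _].
  have /rowV0Pn[v /sub_kermxP vX v0'] : kermx X^T != 0.
    by rewrite -mxrank_eq0 mxrank_ker -lt0n subn_gt0.
  have vT0 : v^T != 0.
    by apply: contra v0' => /eqP/(congr1 trmx); rewrite trmxK trmx0 => ->.
  have [a a0 aa] := normalize_col vT0.
  exists 0, (a *: v^T); split=> //; last by rewrite v0 scale0r.
  by rewrite -scalemxAr -(trmxK X) -trmx_mul vX trmx0 scaler0 scale0r.
have [H1 oH1 H1e] := orthogonal_first_col uu.
have [H2 oH2 H2e] := orthogonal_first_col ww.
pose X' : 'M[R]_(1 + n, 1 + m) := H1^T *m X *m H2.
have X'E : X' = block_mx s%:M 0 0 (drsubmx X').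
  apply: block_first_rowcol.
    by rewrite /X' -!mulmxA H2e Xw -scalemxAr -H1e orthogonalK.
  by rewrite /X' !trmx_mul trmxK -!mulmxA H1e XTu -scalemxAr -H2e orthogonalK.
have [U2 [W2 [d2 [oU2 oW2 E2]]]] := IHn _ (drsubmx X') nm.
pose U : 'M[R]_(1 + n) := H1 *m block_mx 1%:M 0 0 U2.
pose W : 'M[R]_(1 + m) := H2 *m block_mx 1%:M 0 0 W2.
exists U, W, (col_mx s%:M d2); split.
- by apply: orthogonalM => //; apply: (@orthogonal_block 1 _) => //; exact: orthogonal1.
- by apply: orthogonalM => //; apply: (@orthogonal_block 1 _) => //; exact: orthogonal1.
have -> : X = H1 *m X' *m H2^T.
  by rewrite /X' -!mulmxA orthogonalr// mulmx1 orthogonalKr.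
clearbody X'.
rewrite /U /W trmx_mul -!mulmxA; congr (_ *m _); rewrite !mulmxA; congr (_ *m _).
have -> : rect_diag (1 + m) (col_mx s%:M d2) = block_mx s%:M 0 0 (rect_diag m d2).
  rewrite -[LHS]submxK; congr block_mx; apply/matrixP => i j; rewrite !mxE.
  - by rewrite !ord1 (unsplitK (inl _)) !mxE.
  - by rewrite !ord1 mulr0n.
  - by rewrite !ord1 mulr0n.
  - by rewrite (unsplitK (inr _)) eqSS.
rewrite {1}X'E E2; symmetry; exact: deflated_conj.
Qed.

End Orthogonal.

(** * The trace inequality *)

Section RootMultiset.
Context (R : realType).

Lemma prod_XsubC_perm n (f g : 'I_n -> R) :
  \prod_i ('X - (f i)%:P) = \prod_i ('X - (g i)%:P) ->
  exists s : 'S_n, forall i, f i = g (s i).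
Proof.
pose fs := [tuple f i | i < n]; pose gs := [tuple g i | i < n].
move=> fg; have /tuple_permP[s sE] : perm_eq fs gs.
  apply: prod_XsubC_eq; rewrite !big_tuple.
  by under eq_bigr do rewrite tnth_mktuple; under [RHS]eq_bigr do rewrite tnth_mktuple.
exists s => i; have := congr1 (fun t => tnth t i) (val_inj sE : fs = _).
by rewrite !tnth_mktuple.
Qed.

Lemma eigvals_conj n (U A : 'M[R]_n) : orthogonal U ->
  eigvals (U *m A *m U^T) = eigvals A.
Proof.
move=> oU; rewrite /eigvals /is_eigvals.
have uU : U^T \in unitmx by have /mulmx1_unit[] := oU.
have UE : U = invmx U^T by rewrite -[LHS](mulKmx uU) oU mulmx1.
by rewrite {1}UE char_poly_conjmx.
Qed.

Lemma eigvals_conj_diag n (U : 'M[R]_n) (d : 'cV[R]_n) : orthogonal U ->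
  exists s : 'S_n, forall i,
    eigvals (U *m diag_mx d^T *m U^T) i 0 = d (s i) 0.
Proof.
move=> oU; rewrite (eigvals_conj _ oU).
have [_ cd] := eigvalsP (tr_diag_mx d^T).
apply: (prod_XsubC_perm (f := fun i => eigvals (diag_mx d^T) i 0)
  (g := fun i => d i 0)).
rewrite -cd char_poly_trig ?diag_mx_is_trig//.
by apply: eq_bigr => i _; rewrite !mxE eqxx.
Qed.

Lemma rect_diag_mul_tr n m (d : 'cV[R]_n) : (n <= m)%N ->
  rect_diag m d *m (rect_diag m d)^T = diag_mx (\row_i (d i 0 ^+ 2)).
Proof.
move=> nm; apply/matrixP => i j; rewrite !mxE.
rewrite (bigD1 (widen_ord nm i))//= !mxE eqxx mulr1n big1 ?addr0.
  rewrite eq_sym -val_eqE /=.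
  have [/val_inj ->|_] := eqVneq (i : nat) j; first by rewrite !mulr1n.
  by rewrite !mulr0n mulr0.
move=> k ki; rewrite !mxE (_ : (i == k :> nat) = false) ?mulr0n ?mul0r//.
by apply/negbTE; apply: contra ki => /eqP ik; apply/eqP/val_inj.
Qed.

Lemma singvals_conj_diag n m (U : 'M[R]_n) (W : 'M[R]_m) (d : 'cV[R]_n) :
  (n <= m)%N -> orthogonal U -> orthogonal W ->
  exists s : 'S_n, forall i,
    singvals (U *m rect_diag m d *m W^T) i 0 = `|d (s i) 0|.
Proof.
move=> nm oU oW.
have [s sE] := eigvals_conj_diag (\col_i (d i 0 ^+ 2)) oU.
exists s => i; rewrite mxE.
have -> : U *m rect_diag m d *m W^T *m (U *m rect_diag m d *m W^T)^T =
    U *m diag_mx (\col_i (d i 0 ^+ 2))^T *m U^T.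
  rewrite !trmx_mul trmxK -!mulmxA orthogonalK// (mulmxA (rect_diag m d)).
  rewrite rect_diag_mul_tr//; congr (_ *m (diag_mx _ *m _)).
  by apply/rowP => k; rewrite !mxE.
by rewrite sE mxE sqrtr_sqr.
Qed.

Lemma eigvals_sorted n (A : 'M[R]_n) : A^T = A ->
  forall i j : 'I_n, (i <= j)%N -> eigvals A j 0 <= eigvals A i 0.
Proof. by move=> /eigvalsP[]. Qed.

Lemma singvals_sorted n m (A : 'M[R]_(n, m)) (i j : 'I_n) : (i <= j)%N ->
  singvals A j 0 <= singvals A i 0.
Proof.
move=> ij; rewrite !mxE ler_wsqrtr// eigvals_sorted//.
by rewrite trmx_mul trmxK.
Qed.

Lemma singvals_ge0 n m (A : 'M[R]_(n, m)) (i : 'I_n) : 0 <= singvals A i 0.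
Proof. by rewrite mxE sqrtr_ge0. Qed.

End RootMultiset.

Section Rearrangement.
Context (R : realType).

(** The coefficients are the differences of consecutive entries of [x]. *)
Lemma layer_cake n (x : 'I_n -> R) : (forall i, 0 <= x i) ->
  (forall i j : 'I_n, (i <= j)%N -> x j <= x i) ->
  exists2 c : 'I_n -> R, forall k, 0 <= c k &
    forall i, x i = \sum_k c k * (i <= k)%N%:R.
Proof.
move=> x0 xd.
(* [x] continued by 0, so that the last difference is the last entry *)
pose X (k : nat) := if insub k is Some i then x i else 0.
have XE (i : 'I_n) : X i = x i by rewrite /X valK.
have Xd k : X k.+1 <= X k.
  rewrite /X; case: insubP => [j _ jE|_].
    case: insubP => [i _ iE|/negP h]; first by apply: xd; rewrite iE jE.
    by exfalso; apply: h; rewrite ltnW// -jE ltn_ord.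
  by case: insubP.
exists (fun k => X k - X k.+1) => [k|i]; first by rewrite subr_ge0.
rewrite -(big_mkord xpredT (fun k => (X k - X k.+1) * (i <= k)%N%:R)).
rewrite (big_cat_nat (n := i))//=; last exact: ltnW.
rewrite big_nat big1 ?add0r => [|k /andP[_ ki]]; last by rewrite leqNgt ki mulr0.
rewrite (eq_big_nat _ _ (F2 := fun k => - X k.+1 - - X k)); last first.
  move=> k /andP[ik _].
  by rewrite ik mulr1 opprK addrC.
rewrite telescope_sumr; last exact: ltnW.
by rewrite opprK XE [X n]/X insubN ?ltnn// oppr0 add0r.
Qed.

(** By bilinearity it is enough to treat indicators of initial segments, where
    the sum over a block of [D] is at most the length of its shorter side. *)
Lemma substochastic_rearrangement n (x y : 'I_n -> R) (D : 'I_n -> 'I_n -> R) :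
  (forall i, 0 <= x i) -> (forall i, 0 <= y i) ->
  (forall i j : 'I_n, (i <= j)%N -> x j <= x i) ->
  (forall i j : 'I_n, (i <= j)%N -> y j <= y i) ->
  (forall i j, 0 <= D i j) -> (forall i, \sum_j D i j <= 1) ->
  (forall j, \sum_i D i j <= 1) ->
  \sum_i \sum_j x i * y j * D i j <= \sum_i x i * y i.
Proof.
move=> x0 y0 xd yd D0 Dr Dc.
have [c c0 xE] := layer_cake x0 xd; have [b b0 yE] := layer_cake y0 yd.
have ind01 k l : (0 : R) <= (k <= l)%N%:R by rewrite ler0n.
have -> : \sum_i \sum_j x i * y j * D i j = \sum_k \sum_l c k * b l *
    \sum_(i < n) \sum_(j < n) (i <= k)%N%:R * (j <= l)%N%:R * D i j.
  transitivity (\sum_(i < n) \sum_(j < n) \sum_k \sum_l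
      c k * b l * ((i <= k)%N%:R * (j <= l)%N%:R * D i j)).
    do 2 (apply: eq_bigr => ? _); rewrite xE yE mulr_suml mulr_suml.
    apply: eq_bigr => k _; rewrite mulr_sumr mulr_suml; apply: eq_bigr => l _.
    by ring.
  under eq_bigr do rewrite exchange_big /=.
  rewrite exchange_big /=; apply: eq_bigr => k _.
  under eq_bigr do rewrite exchange_big /=.
  rewrite exchange_big /=; apply: eq_bigr => l _.
  by rewrite mulr_sumr; apply: eq_bigr => i _; rewrite mulr_sumr.
have -> : \sum_i x i * y i = \sum_k \sum_l c k * b l *
    \sum_(i < n) (i <= k)%N%:R * (i <= l)%N%:R.
  transitivity (\sum_(i < n) \sum_k \sum_l c k * b l * ((i <= k)%N%:R * (i <= l)%N%:R)).
    apply: eq_bigr => i _; rewrite xE yE mulr_suml; apply: eq_bigr => k _.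
    by rewrite mulr_sumr; apply: eq_bigr => l _; ring.
  rewrite exchange_big /=; apply: eq_bigr => k _.
  rewrite exchange_big /=; apply: eq_bigr => l _.
  by rewrite mulr_sumr.
apply: ler_sum => k _; apply: ler_sum => l _.
rewrite ler_wpM2l ?mulr_ge0//.
have [kl|/ltnW lk] := leqP k l.
  apply: ler_sum => i _; have [ik|_] := leqP i k; last first.
    by rewrite mul0r big1// => j _; rewrite !mul0r.
  rewrite (leq_trans ik kl) mul1r; apply: le_trans (Dr i).
  by apply: ler_sum => j _; rewrite mul1r ler_piMl// lern1 leq_b1.
rewrite exchange_big /=; apply: ler_sum => j _; have [jl|_] := leqP j l; last first.
  by rewrite mulr0 big1// => i _; rewrite mulr0 mul0r.
rewrite (leq_trans jl lk) mul1r; apply: le_trans (Dc j).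
by apply: ler_sum => i _; rewrite mulr1 ler_piMl// lern1 leq_b1.
Qed.

(** With unit row and column sums, both sides change by the same amount when
    constants are added to [x] and [y]. *)
Lemma stochastic_rearrangement n (x y : 'I_n -> R) (D : 'I_n -> 'I_n -> R) :
  (forall i j : 'I_n, (i <= j)%N -> x j <= x i) ->
  (forall i j : 'I_n, (i <= j)%N -> y j <= y i) ->
  (forall i j, 0 <= D i j) -> (forall i, \sum_j D i j = 1) ->
  (forall j, \sum_i D i j = 1) ->
  \sum_i \sum_j x i * y j * D i j <= \sum_i x i * y i.
Proof.
move=> xd yd D0 Dr Dc.
pose a : R := \sum_i `|x i|; pose b : R := \sum_i `|y i|.
have lb (z : 'I_n -> R) i : 0 <= z i + \sum_i `|z i|.
  rewrite (bigD1 i)//= addrA addr_ge0 ?sumr_ge0//.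
  by rewrite -lerBlDl sub0r -normrN ler_norm.
move: (lb x) (lb y); rewrite -/a -/b; move: a b => a b lbx lby.
have := @substochastic_rearrangement n (fun i => x i + a) (fun i => y i + b) D
  lbx lby _ _ D0 _ _.
have H1 : \sum_i \sum_j (x i + a) * (y j + b) * D i j =
   \sum_i \sum_j x i * y j * D i j + (b * \sum_i x i + a * \sum_j y j + n%:R * (a * b)).
  transitivity (\sum_i (\sum_j x i * y j * D i j +
      (b * x i + a * \sum_j y j * D i j + a * b))).
    apply: eq_bigr => i _.
    rewrite -[in RHS](mulr1 (b * x i)) -[in RHS](mulr1 (a * b)) -(Dr i).
    by rewrite !mulr_sumr -!big_split /=; apply: eq_bigr => j _; ring.
  have Hy : \sum_(i < n) \sum_(j < n) y j * D i j = \sum_j y j.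
    by rewrite exchange_big; apply: eq_bigr => j _; rewrite -mulr_sumr Dc mulr1.
  rewrite !big_split /= -!mulr_sumr Hy sumr_const card_ord -[b *+ n]mulr_natr.
  ring.
have H2 : \sum_i (x i + a) * (y i + b) =
   \sum_i x i * y i + (b * \sum_i x i + a * \sum_j y j + n%:R * (a * b)).
  transitivity (\sum_i (x i * y i + (b * x i + a * y i + a * b))).
    by apply: eq_bigr => i _; ring.
  by rewrite !big_split /= -!mulr_sumr sumr_const card_ord -[b *+ n]mulr_natr; ring.
rewrite H1 H2 lerD2r; apply.
- by move=> i j ij; rewrite lerD2r xd.
- by move=> i j ij; rewrite lerD2r yd.
- by move=> i; rewrite Dr.
- by move=> j; rewrite Dc.
Qed.

Lemma orthogonal_row_sqr n (P : 'M[R]_n) i : orthogonal P ->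
  \sum_j P i j ^+ 2 = 1.
Proof.
move=> /orthogonalr/matrixP/(_ i i); rewrite !mxE eqxx mulr1n => <-.
by apply: eq_bigr => j _; rewrite mxE.
Qed.

Lemma orthogonal_col_sqr n (P : 'M[R]_n) j : orthogonal P ->
  \sum_i P i j ^+ 2 = 1.
Proof.
move=> oP; rewrite -(orthogonal_row_sqr j (orthogonalT oP)).
by apply: eq_bigr => i _; rewrite mxE.
Qed.

End Rearrangement.

Section Trace.
Context (R : realType).

Lemma mxdot_tr m n (A B : 'M[R]_(m, n)) : mxdot A B = \tr (A *m B^T).
Proof.
by rewrite /mxdot -[RHS]mxtrace_tr trmx_mul trmxK mxtrace_mulC.
Qed.

Lemma mxdot_trmx m n (A B : 'M[R]_(m, n)) : mxdot A^T B^T = mxdot A B.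
Proof. by rewrite mxdot_tr trmxK. Qed.

Lemma mxdot_mull m n p (U : 'M[R]_(p, m)) (A : 'M[R]_(m, n)) (B : 'M[R]_(p, n)) :
  mxdot (U *m A) B = mxdot A (U^T *m B).
Proof. by rewrite /mxdot trmx_mul mulmxA. Qed.

Lemma mxdot_mulr m n p (W : 'M[R]_(n, p)) (A : 'M[R]_(m, n)) (B : 'M[R]_(m, p)) :
  mxdot (A *m W) B = mxdot A (B *m W^T).
Proof. by rewrite !mxdot_tr trmx_mul trmxK mulmxA. Qed.

Lemma mxdot_rect_diag n m (nm : (n <= m)%N) (x : 'cV[R]_n) (M : 'M[R]_(n, m)) :
  mxdot (rect_diag m x) M = \sum_i x i 0 * M i (widen_ord nm i).
Proof.
rewrite mxdotE; apply: eq_bigr => i _.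
rewrite (bigD1 (widen_ord nm i))//= !mxE eqxx mulr1n big1 ?addr0// => k ki.
rewrite !mxE (_ : (i == k :> nat) = false) ?mulr0n ?mul0r//.
by apply/negbTE; apply: contra ki => /eqP ik; apply/eqP/val_inj.
Qed.

Lemma mul_rect_diag n m (nm : (n <= m)%N) (x : 'cV[R]_n) (P : 'M[R]_n) (Q : 'M[R]_m) i j :
  (P *m rect_diag m x *m Q) i j = \sum_k P i k * x k 0 * Q (widen_ord nm k) j.
Proof.
rewrite -mulmxA mxE; apply: eq_bigr => k _; rewrite mxE -mulrA; congr (_ * _).
rewrite (bigD1 (widen_ord nm k))//= !mxE eqxx mulr1n big1 ?addr0// => l lk.
rewrite !mxE (_ : (k == l :> nat) = false) ?mulr0n ?mul0r//.
by apply/negbTE; apply: contra lk => /eqP kl; apply/eqP/val_inj.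
Qed.

Lemma mxdot_svd n m (nm : (n <= m)%N) (x y : 'cV[R]_n) (U U' : 'M[R]_n) (W W' : 'M[R]_m) :
  mxdot (U *m rect_diag m x *m W^T) (U' *m rect_diag m y *m W'^T) =
  \sum_i \sum_j x i 0 * y j 0 *
    ((U^T *m U') i j * (W^T *m W') (widen_ord nm i) (widen_ord nm j)).
Proof.
rewrite mxdot_mulr mxdot_mull trmxK.
have -> : U^T *m (U' *m rect_diag m y *m W'^T *m W) =
   (U^T *m U') *m rect_diag m y *m (W^T *m W')^T.
  by rewrite trmx_mul trmxK !mulmxA.
rewrite (mxdot_rect_diag nm); apply: eq_bigr => i _.
rewrite (mul_rect_diag nm) mulr_sumr; apply: eq_bigr => j _.
by rewrite [_^T (widen_ord _ _) _]mxE; ring.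
Qed.

Lemma rect_diag_diag n (x : 'cV[R]_n) : rect_diag n x = diag_mx x^T.
Proof. by apply/matrixP => i j; rewrite !mxE. Qed.

Lemma perm_widen n m (nm : (n <= m)%N) (s : 'S_n) :
  exists t : 'S_m, forall i, t (widen_ord nm i) = widen_ord nm (s i).
Proof.
pose f (j : 'I_m) := if insub (j : nat) is Some i then widen_ord nm (s i) else j.
have fw i : f (widen_ord nm i) = widen_ord nm (s i) by rewrite /f /= valK.
have fj (j : 'I_m) : (n <= j)%N -> f j = j.
  by move=> nj; rewrite /f insubN// -leqNgt.
have cases (j : 'I_m) : (exists i, j = widen_ord nm i) \/ (n <= j)%N.
  have [jn|] := ltnP j n; last by right.
  by left; exists (Ordinal jn); exact: val_inj.
have fI : injective f.
  move=> j k.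
  have wI : injective (widen_ord nm) by move=> a b /(congr1 val) /= /val_inj.
  have [[i ->]|nj] := cases j; have [[l ->]|nk] := cases k.
  - by rewrite !fw => /wI/perm_inj ->.
  - rewrite fw (fj _ nk) => /(congr1 val) /= E.
    by move: nk; rewrite -E leqNgt ltn_ord.
  - rewrite fw (fj _ nj) => /(congr1 val) /= E.
    by move: nj; rewrite E leqNgt ltn_ord.
  - by rewrite !fj.
by exists (perm fI) => i; rewrite permE fw.
Qed.

Lemma orthogonal_perm n (s : 'S_n) : orthogonal (perm_mx s : 'M[R]_n).
Proof.
by rewrite /orthogonal tr_perm_mx -perm_mxM mulVg perm_mx1.
Qed.

Lemma diag_mx_perm n (s : 'S_n) (d : 'cV[R]_n) :
  diag_mx (\col_i d (s i) 0)^T = perm_mx s *m diag_mx d^T *m (perm_mx s)^T.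
Proof.
rewrite tr_perm_mx -col_permE -row_permE; apply/matrixP => i j.
by rewrite !mxE (inj_eq perm_inj).
Qed.

Lemma rect_diag_signed_perm n m (nm : (n <= m)%N) (s : 'S_n) (e d : 'cV[R]_n) :
  (forall i, e i 0 ^+ 2 = 1) ->
  exists (P : 'M[R]_n) (Q : 'M[R]_m), [/\ orthogonal P, orthogonal Q &
    rect_diag m (\col_i (e i 0 * d (s i) 0)) = P *m rect_diag m d *m Q^T].
Proof.
move=> e1; have [t tE] := perm_widen nm s.
exists (diag_mx e^T *m perm_mx s), (perm_mx t); split.
- apply: orthogonalM; last exact: orthogonal_perm.
  rewrite /orthogonal tr_diag_mx mulmx_diag; apply/matrixP => i j.
  by rewrite !mxE -expr2 e1.
- exact: orthogonal_perm.
apply/matrixP => i j; rewrite (mul_rect_diag nm) [LHS]mxE mxE.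
rewrite (bigD1 (s i))//= big1 ?addr0 => [|k ks].
  rewrite mul_diag_mx !mxE eqxx mulr1 -tE (inj_eq perm_inj) eq_sym -val_eqE /=.
  by rewrite mulr_natr.
by rewrite mul_diag_mx !mxE eq_sym (negbTE ks) mulr0 !mul0r.
Qed.

Lemma eigvals_diagonalize n (X : 'M[R]_n) : X^T = X ->
  exists2 U, orthogonal U & X = U *m diag_mx (eigvals X : 'cV_n)^T *m U^T.
Proof.
move=> /real_spectral[U [d [oU XE]]].
have [s sE] := eigvals_conj_diag d oU; rewrite -XE in sE.
have oP := orthogonal_perm s.
exists (U *m (perm_mx s)^T).
  by apply: orthogonalM => //; exact: orthogonalT.
have -> : (eigvals X : 'cV_n) = \col_i d (s i) 0.
  by apply/colP => i; rewrite sE mxE.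
rewrite diag_mx_perm trmx_mul trmxK -!mulmxA orthogonalK//.
by rewrite orthogonalK// !mulmxA.
Qed.

Lemma singvals_decompose n m (X : 'M[R]_(n, m)) : (n <= m)%N ->
  exists (U : 'M[R]_n) (W : 'M[R]_m), [/\ orthogonal U, orthogonal W &
    X = U *m rect_diag m (singvals X : 'cV_n) *m W^T].
Proof.
move=> nm; have [U [W [d [oU oW XE]]]] := real_svd X nm.
have [s sE] := singvals_conj_diag d nm oU oW; rewrite -XE in sE.
pose e : 'cV[R]_n := \col_i (if 0 <= d (s i) 0 then 1 else -1).
have [|P [Q [oP oQ PQ]]] := @rect_diag_signed_perm _ _ nm s e d.
  by move=> i; rewrite mxE; case: ifP; rewrite ?sqrrN expr1n.
have sX : (singvals X : 'cV_n) = \col_i (e i 0 * d (s i) 0).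
  apply/colP => i; rewrite sE !mxE; case: ifPn => h.
    by rewrite mul1r ger0_norm.
  by rewrite mulN1r ltr0_norm// ltNge.
exists (U *m P^T), (W *m Q^T); split.
- by apply: orthogonalM => //; exact: orthogonalT.
- by apply: orthogonalM => //; exact: orthogonalT.
rewrite sX PQ trmx_mul trmxK -!mulmxA orthogonalK// orthogonalK//.
by rewrite !mulmxA.
Qed.

(** Von Neumann's inequality for symmetric matrices: the squared entries of an
    orthogonal matrix are doubly stochastic. *)
Lemma eigvals_trace n (X Y : 'M[R]_n) : X^T = X -> Y^T = Y ->
  mxdot X Y <= mxdot (eigvals X : 'cV_n) (eigvals Y : 'cV_n).
Proof.
move=> XT YT.
have [U oU XE] := eigvals_diagonalize XT.
have [V oV YE] := eigvals_diagonalize YT.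
rewrite {1}XE {1}YE -!rect_diag_diag (mxdot_svd (leqnn n)).
have oP : orthogonal (U^T *m V) by apply: orthogonalM => //; exact: orthogonalT.
rewrite [leRHS]mxdotE; under [leRHS]eq_bigr do rewrite big_ord1.
have wE i : widen_ord (leqnn n) i = i by exact: val_inj.
rewrite (eq_bigr (fun i : 'I_n => \sum_j eigvals X i 0 * eigvals Y j 0 *
    (U^T *m V) i j ^+ 2)); last first.
  by move=> i _; apply: eq_bigr => j _; rewrite !wE expr2.
apply: stochastic_rearrangement.
- exact: eigvals_sorted.
- exact: eigvals_sorted.
- by move=> i j; rewrite sqr_ge0.
- by move=> i; exact: orthogonal_row_sqr.
- by move=> j; exact: orthogonal_col_sqr.
Qed.

(** Von Neumann's inequality for singular values.  The relevant products of
    entries of two orthogonal matrices are at most the mean of the squares,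
    and these means form a doubly substochastic matrix. *)
Lemma singvals_trace n m (X Y : 'M[R]_(n, m)) : (n <= m)%N ->
  mxdot X Y <= mxdot (singvals X : 'cV_n) (singvals Y : 'cV_n).
Proof.
move=> nm.
have [U [W [oU oW XE]]] := singvals_decompose X nm.
have [U' [W' [oU' oW' YE]]] := singvals_decompose Y nm.
rewrite {1}XE {1}YE (mxdot_svd nm).
have oP : orthogonal (U^T *m U') by apply: orthogonalM => //; exact: orthogonalT.
have oQ : orthogonal (W^T *m W') by apply: orthogonalM => //; exact: orthogonalT.
move: oP oQ; set P := U^T *m U'; set Q := W^T *m W' => oP oQ.
rewrite [leRHS]mxdotE; under [leRHS]eq_bigr do rewrite big_ord1.
pose w := widen_ord nm.
have wI : injective w by move=> a b /(congr1 val) /= /val_inj.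
have part (F : 'I_m -> R) : (forall j, 0 <= F j) -> \sum_i F (w i) <= \sum_j F j.
  move=> F0; rewrite -(big_imset F (A := 'I_n))/=; last by move=> ? ? _ _; exact: wI.
  by rewrite [leRHS](bigID (mem (w @: 'I_n)))/= lerDl sumr_ge0.
pose D i j : R := (P i j ^+ 2 + Q (w i) (w j) ^+ 2) / 2.
apply: (@le_trans _ _ (\sum_i \sum_j singvals X i 0 * singvals Y j 0 * D i j)).
  apply: ler_sum => i _; apply: ler_sum => j _.
  rewrite ler_wpM2l ?mulr_ge0 ?singvals_ge0// /D.
  have := sqr_ge0 (P i j - Q (w i) (w j)); rewrite -/w; lra.
apply: substochastic_rearrangement.
- by move=> i; exact: singvals_ge0.
- by move=> i; exact: singvals_ge0.
- exact: singvals_sorted.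
- exact: singvals_sorted.
- by move=> i j; rewrite divr_ge0 ?addr_ge0 ?sqr_ge0.
- move=> i; rewrite -mulr_suml big_split/= orthogonal_row_sqr//.
  have := part (fun j => Q (w i) j ^+ 2) (fun j => sqr_ge0 _).
  rewrite orthogonal_row_sqr//; lra.
- move=> j; rewrite -mulr_suml big_split/= orthogonal_col_sqr//.
  have := part (fun i => Q i (w j) ^+ 2) (fun j => sqr_ge0 _).
  rewrite orthogonal_col_sqr//; lra.
Qed.

End Trace.

(** * Orbits of the orthogonal group *)

Section Frobenius.
Context (R : realType).

(** The norm of [emx], but on plain matrices, which have products of all
    shapes. *)
Definition frob m n (A : 'M[R]_(m, n)) : R := `|(A : emx R m n)|.

Lemma frob_sqr m n (A : 'M[R]_(m, n)) : frob A ^+ 2 = mxdot A A.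
Proof. exact: esym (dotp_norm (A : emx R m n)). Qed.

Lemma frob_sqrE m n (A : 'M[R]_(m, n)) :
  frob A ^+ 2 = \sum_i \sum_j A i j ^+ 2.
Proof. by rewrite frob_sqr mxdotE; do 2 (apply: eq_bigr => ? _); rewrite expr2. Qed.

Lemma frob_ge0 m n (A : 'M[R]_(m, n)) : 0 <= frob A.
Proof. exact: normr_ge0. Qed.

Lemma frobD m n (A B : 'M[R]_(m, n)) : frob (A + B) <= frob A + frob B.
Proof. exact: (ler_normD (A : emx R m n) B). Qed.

Lemma frobB m n (A B : 'M[R]_(m, n)) : frob (A - B) <= frob A + frob B.
Proof. exact: (ler_normB (A : emx R m n) B). Qed.

Lemma frobC m n (A B : 'M[R]_(m, n)) : frob (A - B) = frob (B - A).
Proof. exact: (distrC (A : emx R m n) B). Qed.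

Lemma frob_le m n p q (A : 'M[R]_(m, n)) (B : 'M[R]_(p, q)) :
  mxdot A A <= mxdot B B -> frob A <= frob B.
Proof. by rewrite -!frob_sqr ler_sqr ?nnegrE ?frob_ge0. Qed.

Lemma frob_eq m n p q (A : 'M[R]_(m, n)) (B : 'M[R]_(p, q)) :
  mxdot A A = mxdot B B -> frob A = frob B.
Proof. by move=> AB; apply/le_anti; rewrite !frob_le ?AB. Qed.

Lemma frobT m n (A : 'M[R]_(m, n)) : frob A^T = frob A.
Proof. by apply: frob_eq; rewrite mxdot_trmx. Qed.

Lemma mxdot_orthl m n (U : 'M[R]_m) (A B : 'M[R]_(m, n)) : orthogonal U ->
  mxdot (U *m A) (U *m B) = mxdot A B.
Proof. by move=> oU; rewrite mxdot_mull orthogonalK. Qed.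

Lemma mxdot_orthr m n (W : 'M[R]_n) (A B : 'M[R]_(m, n)) : orthogonal W ->
  mxdot (A *m W) (B *m W) = mxdot A B.
Proof.
by move=> oW; rewrite mxdot_mulr -mulmxA orthogonalr// mulmx1.
Qed.

Lemma frob_orthl m n (U : 'M[R]_m) (A : 'M[R]_(m, n)) : orthogonal U ->
  frob (U *m A) = frob A.
Proof. by move=> oU; apply: frob_eq; rewrite mxdot_orthl. Qed.

Lemma frob_orthr m n (W : 'M[R]_n) (A : 'M[R]_(m, n)) : orthogonal W ->
  frob (A *m W) = frob A.
Proof. by move=> oW; apply: frob_eq; rewrite mxdot_orthr. Qed.

Lemma frobM m n p (A : 'M[R]_(m, n)) (B : 'M[R]_(n, p)) :
  frob (A *m B) <= frob A * frob B.
Proof.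
rewrite -ler_sqr ?nnegrE ?mulr_ge0 ?frob_ge0// exprMn !frob_sqrE.
rewrite [X in _ <= _ * X]exchange_big /= mulr_suml; apply: ler_sum => i _.
rewrite mulr_sumr; apply: ler_sum => j _; rewrite mxE.
pose a : vec R n := \col_k A i k; pose b : vec R n := \col_k B k j.
have E : \sum_k A i k * B k j = dotp a b.
  by rewrite /dotp /= mxdotE; apply: eq_bigr => k _; rewrite big_ord1 !mxE.
have Ea : \sum_k A i k ^+ 2 = `|a| ^+ 2.
  by rewrite [RHS](frob_sqrE a); apply: eq_bigr => k _; rewrite big_ord1 mxE.
have Eb : \sum_k B k j ^+ 2 = `|b| ^+ 2.
  by rewrite [RHS](frob_sqrE b); apply: eq_bigr => k _; rewrite big_ord1 mxE.
rewrite E Ea Eb -exprMn -[leLHS]real_normK ?num_real//.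
by rewrite lerXn2r ?nnegrE ?mulr_ge0// normr_dotp.
Qed.

Lemma frob_submx_le m n p q (A : 'M[R]_(m + p, n + q)) :
  frob (ulsubmx A) <= frob A /\ frob (drsubmx A) <= frob A.
Proof.
suff E : mxdot A A = mxdot (ulsubmx A) (ulsubmx A) + mxdot (ursubmx A) (ursubmx A) +
   (mxdot (dlsubmx A) (dlsubmx A) + mxdot (drsubmx A) (drsubmx A)).
  have ge0 s t (X : 'M[R]_(s, t)) : 0 <= mxdot X X by rewrite -frob_sqr sqr_ge0.
  by split; apply: frob_le; rewrite E;
    have := ge0 _ _ (dlsubmx A); have := ge0 _ _ (drsubmx A);
    have := ge0 _ _ (ursubmx A); have := ge0 _ _ (ulsubmx A); lra.
rewrite -{1 2}(submxK A) !mxdot_tr tr_block_mx mulmx_block mxtrace_block.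
by rewrite !raddfD.
Qed.

End Frobenius.

Section Polar.
Context (R : realType) (N : nat).
Implicit Types B D J M Q T : 'M[R]_N.

(** The witness is the orthogonal polar factor [D *m (D^T *m D)^(-1/2)].  What
    commutes with [D^T *m D] commutes with its functions: in an eigenbasis, its
    entry [i, j] is nonzero only if the eigenvalues [i] and [j] agree. *)
Lemma polar_near D : frob (D^T *m D - 1%:M) < 1 ->
  exists Q, [/\ orthogonal Q, frob (D - Q) <= frob (D^T *m D - 1%:M) &
    forall T, T *m D = D *m T -> T *m D^T = D^T *m T -> T *m Q = Q *m T].
Proof.
set M := D^T *m D => M1.
have MT : M^T = M by rewrite /M trmx_mul trmxK.
have [U [s [oU ME]]] := real_spectral MT.
(* the function [phi] of the symmetric matrix [M] *)
pose F (phi : R -> R) := U *m diag_mx (\row_i phi (s i 0)) *m U^T.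
have FM phi psi : F phi *m F psi = F (fun x => phi x * psi x).
  rewrite /F -!mulmxA orthogonalK// (mulmxA (diag_mx _)) mulmx_diag !mulmxA.
  by congr (_ *m diag_mx _ *m _); apply/rowP => i; rewrite !mxE.
have FidE : F id = M.
  by rewrite ME /F; congr (_ *m diag_mx _ *m _); apply/rowP => i; rewrite !mxE.
have F1 phi : (forall i, phi (s i 0) = 1) -> F phi = 1%:M.
  move=> phi1; rewrite /F (_ : diag_mx _ = 1%:M) ?mulmx1 ?orthogonalr//.
  by apply/matrixP => i j; rewrite !mxE phi1.
have FB phi psi : mxdot (F phi - F psi) (F phi - F psi) =
    \sum_i (phi (s i 0) - psi (s i 0)) ^+ 2.
  rewrite /F -mulmxBl -mulmxBr mxdot_orthr; last exact: orthogonalT.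
  rewrite mxdot_orthl// mxdotE; apply: eq_bigr => i _.
  rewrite (bigD1 i)//= !mxE eqxx !mulr1n -expr2 big1 ?addr0// => j ji.
  by rewrite !mxE eq_sym (negbTE ji) !mulr0n subrr mul0r.
have FT phi : (F phi)^T = F phi by rewrite /F !trmx_mul trmxK tr_diag_mx mulmxA.
have Fc phi T : T *m M = M *m T -> T *m F phi = F phi *m T.
  move=> TM; pose T' := U^T *m T *m U.
  have TE : T = U *m T' *m U^T.
    by rewrite /T' -!mulmxA orthogonalr// mulmx1 orthogonalKr.
  have sc (d : 'rV[R]_N) : T *m (U *m diag_mx d *m U^T) = U *m (T' *m diag_mx d) *m U^T.
    by rewrite {1}TE -!mulmxA orthogonalK.
  have cs (d : 'rV[R]_N) : U *m diag_mx d *m U^T *m T = U *m (diag_mx d *m T') *m U^T.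
    by rewrite {1}TE -!mulmxA orthogonalK.
  have cancel2 (X Y : 'M[R]_N) : U *m X *m U^T = U *m Y *m U^T -> X = Y.
    move=> /(congr1 (fun Z => U^T *m Z *m U)).
    by rewrite -!mulmxA !orthogonalK// oU !mulmx1.
  rewrite /F sc cs; congr (_ *m _ *m _).
  move: TM; rewrite ME sc cs => /cancel2/matrixP TM.
  apply/matrixP => i j; have := TM i j; rewrite !mul_mx_diag !mul_diag_mx !mxE.
  rewrite mulrC => /eqP; rewrite -subr_eq0 -mulrBl mulf_eq0 subr_eq0.
  by move=> /orP[/eqP ->|/eqP ->]; rewrite ?mulr0 ?mul0r// mulrC.
have M1E : mxdot (M - 1%:M) (M - 1%:M) = \sum_i (s i 0 - 1) ^+ 2.
  by rewrite -FidE -(F1 (fun=> 1))// FB.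
clearbody F.
have s0 i : 0 < s i 0.
  have : (s i 0 - 1) ^+ 2 < 1.
    apply: le_lt_trans (_ : frob (M - 1%:M) ^+ 2 < 1); last first.
      by move: M1 (frob_ge0 (M - 1%:M)); nra.
    rewrite frob_sqr M1E (bigD1 i)//= lerDl sumr_ge0// => j _.
    exact: sqr_ge0.
  nra.
pose r x : R := Num.sqrt x; pose ri x : R := (Num.sqrt x)^-1.
have rs i : r (s i 0) ^+ 2 = s i 0 by rewrite sqr_sqrtr// ltW.
have r0 i : 0 < r (s i 0) by rewrite sqrtr_gt0.
have oQ : orthogonal (D *m F ri).
  rewrite /orthogonal trmx_mul FT -mulmxA (mulmxA D^T) -/M -FidE !FM.
  apply: F1 => i /=; rewrite -[X in _ * (X * _)]rs /ri -/(r (s i 0)).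
  by field; rewrite gt_eqF.
exists (D *m F ri); split=> //.
  have -> : D - D *m F ri = D *m F ri *m (F r - F (fun=> 1)).
    rewrite mulmxBr -!mulmxA FM (F1 (fun=> 1))// mulmx1; congr (_ - _).
    by rewrite F1 ?mulmx1// => i; rewrite mulVf// gt_eqF//; exact: r0.
  rewrite frob_orthl//; apply: frob_le; rewrite FB M1E; apply: ler_sum => i _.
  have rge := r0 i; rewrite -[X in _ <= (X - 1) ^+ 2]rs.
  rewrite (_ : (r (s i 0) ^+ 2 - 1) ^+ 2 =
    (r (s i 0) - 1) ^+ 2 * (r (s i 0) + 1) ^+ 2); last by ring.
  rewrite ler_peMr ?sqr_ge0// -(expr1n _ 2) lerXn2r ?nnegrE//; lra.
move=> T TD TDT; rewrite mulmxA TD -!mulmxA; congr (_ *m _).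
by apply: Fc; rewrite /M mulmxA TDT -!mulmxA TD.
Qed.

(** The kernel of [f] below is the commutant of [T] and [J].  A point [D] of it
    near [B] is almost orthogonal, and its polar factor is again in the
    commutant. *)
Lemma orthogonal_commutant T J : T^T = T -> J^T = J ->
  exists2 c : R, 0 < c & forall B, orthogonal B -> B *m J = J *m B ->
    exists Q, [/\ orthogonal Q, Q *m J = J *m Q, Q *m T = T *m Q &
      frob (B - Q) <= c * frob (B *m T - T *m B)].
Proof.
move=> TT JT.
pose f (X : emx R N N) : emx R N (N + N) :=
  row_mx (X *m T - T *m X) (X *m J - J *m X).
have lf : linear f.
  move=> a X Y; rewrite /f scale_row_mx add_row_mx.
  by congr row_mx; rewrite mulmxDl mulmxDr -scalemxAl -scalemxAr scalerBr opprD addrACA.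
pose fM := GRing.isLinear.Build R (emx R N N) (emx R N (N + N)) *:%R f lf.
pose fL : {linear emx R N N -> emx R N (N + N)} := HB.pack f fM.
have [c1 c10 c1P] := dist_ker_le fL.
pose K : R := frob (1%:M : 'M[R]_N).
have K0 : 0 <= K by exact: frob_ge0.
have frobO B : orthogonal B -> frob B = K.
  by move=> oB; rewrite -[B in LHS]mulmx1 frob_orthl.
exists (((K + 3) + 2 * K * (K + 2)) * c1).
  rewrite mulr_gt0// ltr_pwDl//; first by lra.
  by rewrite !mulr_ge0//; lra.
move=> B oB BJ; set eps := frob (_ - _); pose eta := c1 * eps.
have [D [DT DJ DB]] : exists D : 'M[R]_N,
    [/\ D *m T = T *m D, D *m J = J *m D & frob (B - D) <= eta].
  have [D fD DB] := c1P B; exists D.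
  have fB : `|fL B| = eps.
    rewrite -[LHS]/(frob (row_mx _ _)) BJ subrr /eps.
    apply: frob_eq; rewrite !mxdot_tr tr_row_mx mul_row_col trmx0 mulmx0.
    by rewrite addr0.
  rewrite {}fB in DB.
  have := fD; rewrite -[LHS]/(row_mx _ _) -(row_mx0 R N N N) => /eq_row_mx[].
  move=> /eqP; rewrite subr_eq0 => /eqP DT /eqP; rewrite subr_eq0 => /eqP DJ.
  by split.
have eta0 : 0 <= eta by exact: le_trans (frob_ge0 _) DB.
rewrite -mulrA -/eta.
have [small|big] := ltP ((K + 2) * eta) 1; last first.
  (* [B] is bounded, so the identity is near enough *)
  exists 1%:M; split; rewrite ?mul1mx ?mulmx1//; first exact: orthogonal1.
  apply: le_trans (frobB _ _) _; rewrite frobO// -/K.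
  have : 0 <= (2 * K) * ((K + 2) * eta - 1) by rewrite mulr_ge0//; lra.
  have : 0 <= (K + 3) * eta by rewrite mulr_ge0//; lra.
  lra.
have eta1 : eta < 1 by have : 0 <= K * eta by [rewrite mulr_ge0]; move: small; lra.
have DK : frob D <= K + 1.
  rewrite (_ : D = B - (B - D)); last by rewrite opprB addrCA subrr addr0.
  by apply: le_trans (frobB _ _) _; rewrite frobO//; lra.
have DD : frob (D^T *m D - 1%:M) <= (K + 2) * eta.
  have -> : D^T *m D - 1%:M = D^T *m (D - B) + (D - B)^T *m B.
    rewrite [(D - B)^T]linearB /= mulmxBr mulmxBl oB.
    by rewrite addrA subrK.
  apply: le_trans (frobD _ _) _; rewrite (frob_orthr _ oB) (frobT (D - B)).
  apply: le_trans (lerD (frobM _ _) (lexx _)) _; rewrite frobT frobC.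
  have := ler_pM (frob_ge0 _) (frob_ge0 _) DK DB; lra.
have [Q [oQ QD Qc]] := polar_near (le_lt_trans DD small).
exists Q; split=> //.
- symmetry; apply: Qc; first by [].
  by rewrite -[J in LHS]JT -[J in RHS]JT -!trmx_mul DJ.
- symmetry; apply: Qc; first by [].
  by rewrite -[T in LHS]TT -[T in RHS]TT -!trmx_mul DT.
rewrite (_ : B - Q = (B - D) + (D - Q)); last by rewrite addrA subrK.
apply: le_trans (frobD _ _) _.
have : 0 <= 2 * K * (K + 2) * eta.
  by apply: mulr_ge0 => //; rewrite !mulr_ge0// addr_ge0.
lra.
Qed.

End Polar.

(** * Eigenvalues and singular values as spectral systems *)

Section SpectraInvariance.
Context (R : realType).

Lemma singvals_conj n m (U : 'M[R]_n) (W : 'M[R]_m) (X : 'M[R]_(n, m)) :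
  orthogonal U -> orthogonal W -> singvals (U *m X *m W^T) = singvals X.
Proof.
move=> oU oW; rewrite /singvals.
have -> : U *m X *m W^T *m (U *m X *m W^T)^T = U *m (X *m X^T) *m U^T.
  by rewrite !trmx_mul trmxK -!mulmxA orthogonalK.
by rewrite eigvals_conj.
Qed.

Lemma eigvals_perm n (U : 'M[R]_n) (d : 'cV[R]_n) : orthogonal U ->
  exists2 P : 'M[R]_n, is_perm_mx P &
    eigvals (U *m diag_mx d^T *m U^T) = P *m d.
Proof.
move=> /(eigvals_conj_diag d)[s sE]; exists (perm_mx s).
  exact: perm_mx_is_perm.
by rewrite -row_permE; apply/colP => i; rewrite sE mxE.
Qed.

Lemma singvals_signed_perm n m (U : 'M[R]_n) (W : 'M[R]_m) (d : 'cV[R]_n) :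
  (n <= m)%N -> orthogonal U -> orthogonal W ->
  exists2 P : 'M[R]_n, signed_perm_mx P &
    singvals (U *m rect_diag m d *m W^T) = P *m d.
Proof.
move=> nm oU oW; have [s sE] := singvals_conj_diag d nm oU oW.
pose e : 'rV[R]_n := \row_i (if 0 <= d (s i) 0 then 1 else -1).
exists (diag_mx e *m perm_mx s).
  exists e, (perm_mx s); split=> //; last exact: perm_mx_is_perm.
  by move=> i; rewrite mxE; case: ifP => _; [left|right].
apply/colP => i; rewrite sE -mulmxA -row_permE mul_diag_mx !mxE.
case: ifPn => h; first by rewrite mul1r ger0_norm.
by rewrite mulN1r ltr0_norm// ltNge.
Qed.

Lemma orthogonal_signed_perm n (P : 'M[R]_n) : signed_perm_mx P -> orthogonal P.
Proof.
move=> [e [P0 [e1 /is_perm_mxP[s ->] ->]]]; apply: orthogonalM; last first.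
  exact: orthogonal_perm.
rewrite /orthogonal tr_diag_mx mulmx_diag; apply/matrixP => i j.
by rewrite !mxE; case: (e1 i) => ->; rewrite ?mulrNN mulr1.
Qed.

End SpectraInvariance.

Section SymmetricSystem.
Context (R : realType) (n : nat).
Implicit Types X Y V : symmx R n.

Lemma vsval_sym X : (vsval X : 'M[R]_n)^T = vsval X.
Proof. by apply/symvP; exact: subvsP. Qed.

Definition symdiag (u : vec R n) : symmx R n :=
  vsproj (symv R n) (diag_mx (u : 'cV[R]_n)^T : emx R n n).

Lemma symdiagE u : vsval (symdiag u) = diag_mx (u : 'cV[R]_n)^T.
Proof. by rewrite vsprojK//; apply/symvP; exact: tr_diag_mx. Qed.

Lemma symdiag_linear : linear symdiag.
Proof.
move=> a u v; apply: val_inj; rewrite /= !symdiagE.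
by apply/matrixP => i j; rewrite !mxE mulrnDl mulrnAr.
Qed.

HB.instance Definition _ :=
  GRing.isLinear.Build R (vec R n) (symmx R n) *:%R symdiag symdiag_linear.

Definition symconj (U : 'M[R]_n) X : symmx R n :=
  vsproj (symv R n) (U *m vsval X *m U^T : emx R n n).

Lemma symconjE U X : vsval (symconj U X) = U *m vsval X *m U^T.
Proof.
rewrite vsprojK//; apply/symvP.
by rewrite !trmx_mul trmxK vsval_sym mulmxA.
Qed.

Lemma symmx_dotE X Y : dotp X Y = mxdot (vsval X) (vsval Y).
Proof. by []. Qed.

Lemma symmx_normE X : `|X| = frob (vsval X).
Proof. exact: norm_dotp_eq. Qed.

Definition eigen_spectrum X : vec R n := eigvals (vsval X).

Lemma eigen_system : spectral_system eigen_spectrum symdiag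
  [set A | exists2 U, orthogonal U & A = symconj U].
Proof.
split.
- move=> _ [U oU ->] a X Y; apply: val_inj; rewrite /= !symconjE.
  rewrite (_ : vsval (a *: X + Y) = a *: (vsval X : 'M[R]_n) + vsval Y).
    by rewrite mulmxDr mulmxDl -scalemxAr -scalemxAl.
  exact: linearP.
- move=> _ X Y [U oU ->]; rewrite !symmx_dotE !symconjE mxdot_orthr.
    by rewrite mxdot_orthl.
  exact: orthogonalT.
- move=> _ _ [U oU ->] [V oV ->]; exists (U *m V); first exact: orthogonalM.
  apply: funext => X; apply: val_inj.
  by rewrite /= !symconjE trmx_mul !mulmxA.
- move=> _ [U oU ->]; exists (symconj U^T).
    by exists U^T => //; exact: orthogonalT.
  move=> X; apply: val_inj; rewrite /= !symconjE trmxK -!mulmxA orthogonalr//.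
  by rewrite mulmx1 orthogonalKr.
- move=> u v; rewrite symmx_dotE !symdiagE -!rect_diag_diag (mxdot_rect_diag (leqnn n)).
  rewrite [RHS]mxdotE; apply: eq_bigr => i _; rewrite big_ord1 mxE.
  by rewrite (_ : widen_ord _ _ = i) ?eqxx//; exact: val_inj.
- move=> X; have [U oU XE] := eigvals_diagonalize (vsval_sym X).
  exists (symconj U); first by exists U.
  by apply: val_inj; rewrite /= symconjE symdiagE.
- move=> _ X [U oU ->]; rewrite /eigen_spectrum symconjE symdiagE.
  have [V oV XE] := eigvals_diagonalize (vsval_sym X).
  by rewrite (eigvals_conj _ oU) [in RHS]XE (eigvals_conj _ oV).
- by move=> X Y; apply: eigvals_trace; exact: vsval_sym.
- move=> V; have [c c0 cP] := orthogonal_commutant (vsval_sym V) (trmx0 R n n).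
  exists (2 * c); first by rewrite mulr_gt0.
  move=> _ [B oB ->]; have [|Q [oQ _ QV BQ]] := cP B oB.
    by rewrite mulmx0 mul0mx.
  exists (symconj Q); first by exists Q.
  split.
    by apply: val_inj; rewrite /= symconjE QV -mulmxA orthogonalr// mulmx1.
  have BV : frob (B *m vsval V - vsval V *m B) = `|symconj B V - V|.
    rewrite symmx_normE linearB /= symconjE -[RHS](frob_orthr _ oB).
    by rewrite mulmxBl -!mulmxA oB mulmx1.
  move=> X; rewrite -BV !symmx_normE linearB /= !symconjE.
  rewrite (_ : _ - _ = (B - Q) *m (vsval X) *m B^T + Q *m (vsval X) *m (B - Q)^T).
    apply: le_trans (frobD _ _) _; rewrite frob_orthr; last exact: orthogonalT.
    rewrite -[Q *m _ *m _]mulmxA (frob_orthl _ oQ).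
    apply: le_trans (lerD (frobM _ _) (frobM _ _)) _; rewrite frobT.
    have := frob_ge0 (vsval X); move: BQ; nra.
  rewrite [(B - Q)^T]linearB /= !mulmxBl mulmxBr.
  by rewrite addrA subrK.
Qed.

End SymmetricSystem.

Section RectangularSystem.
Context (R : realType) (n m : nat) (nm : (n <= m)%N).

Definition svddiag (u : vec R n) : emx R n m := rect_diag m u.

Lemma svddiag_linear : linear svddiag.
Proof. by move=> a u v; apply/matrixP => i j; rewrite !mxE mulrnDl mulrnAr. Qed.

HB.instance Definition _ :=
  GRing.isLinear.Build R (vec R n) (emx R n m) *:%R svddiag svddiag_linear.

Definition equivconj (UW : 'M[R]_n * 'M[R]_m) (X : emx R n m) : emx R n m :=
  UW.1 *m X *m UW.2^T.

(** The orbit axiom is the commutation lemma for the symmetric dilation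
    [block_mx 0 V V^T 0]; commuting with [block_mx 1 0 0 (-1)] singles out the
    block-diagonal matrices. *)
Lemma singular_orbit (V : 'M[R]_(n, m)) : exists2 c : R, 0 < c &
  forall (U : 'M[R]_n) (W : 'M[R]_m), orthogonal U -> orthogonal W ->
  exists U' W', [/\ orthogonal U', orthogonal W', U' *m V *m W'^T = V &
    forall X : 'M[R]_(n, m), frob (U *m X *m W^T - U' *m X *m W'^T) <=
      c * frob (U *m V *m W^T - V) * frob X].
Proof.
pose T : 'M[R]_(n + m) := block_mx 0 V V^T 0.
pose J : 'M[R]_(n + m) := block_mx 1%:M 0 0 (- 1%:M).
have TT : T^T = T by rewrite /T tr_block_mx !trmx0 trmxK.
have JT : J^T = J by rewrite /J tr_block_mx !trmx0 linearN/= !trmx1.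
have [c c0 cP] := orthogonal_commutant TT JT.
exists (2 * (c * 2)); first by rewrite !mulr_gt0.
move=> U W oU oW; pose B := block_mx U 0 0 W.
have [||Q [oQ QJ QT BQ]] := cP B.
- exact: orthogonal_block.
- rewrite /B /J !mulmx_block !(mulmx0, mul0mx, mulmx1, mul1mx, addr0, add0r).
  by rewrite mulmxN mulNmx mulmx1 mul1mx.
pose U' := ulsubmx Q; pose W' := drsubmx Q.
have QE : Q = block_mx U' 0 0 W'.
  have := QJ; rewrite -{1 2}(submxK Q) /J !mulmx_block.
  rewrite !(mulmx0, mul0mx, mulmx1, mul1mx, addr0, add0r, mulmxN, mulNmx).
  move=> /eq_block_mx[_ ur dl _].
  have z p q (Z : 'M[R]_(p, q)) : - Z = Z -> Z = 0.
    move=> /eqP; rewrite eq_sym -subr_eq0 opprK -mulr2n => /eqP Z2.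
    by apply/matrixP => i j; have /matrixP/(_ i j) := Z2; rewrite !mxE; lra.
  by rewrite -{1}(submxK Q) (z _ _ _ ur) (z _ _ _ (esym dl)).
have [oU' oW'] : orthogonal U' /\ orthogonal W'.
  move: oQ; rewrite /orthogonal QE tr_block_mx !trmx0 mulmx_block.
  rewrite !(mulmx0, mul0mx, addr0, add0r) (scalar_mx_block _ _ 1).
  by move=> /eq_block_mx[].
have UV : U' *m V = V *m W'.
  move: QT; rewrite QE /T !mulmx_block.
  by rewrite !(mulmx0, mul0mx, addr0, add0r) => /eq_block_mx[].
exists U', W'; split=> //; first by rewrite UV -mulmxA orthogonalr// mulmx1.
have [BU BW] : frob (U - U') <= frob (B - Q) /\ frob (W - W') <= frob (B - Q).
  have := frob_submx_le (B - Q); rewrite QE /B opp_block_mx add_block_mx.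
  by rewrite block_mxKul block_mxKdr.
have BT : frob (B *m T - T *m B) <= 2 * frob (U *m V *m W^T - V).
  have -> : B *m T - T *m B = block_mx 0 (U *m V - V *m W) (W *m V^T - V^T *m U) 0.
    rewrite /B /T !mulmx_block !(mulmx0, mul0mx, addr0, add0r).
    by rewrite opp_block_mx add_block_mx !subr0.
  have e1 : frob (U *m V - V *m W) = frob (U *m V *m W^T - V).
    rewrite -(frob_orthr _ (orthogonalT oW)) mulmxBl -[V *m W *m _]mulmxA.
    by rewrite orthogonalr// mulmx1.
  have e2 : frob (W *m V^T - V^T *m U) = frob (U *m V *m W^T - V).
    rewrite -(frob_orthr _ (orthogonalT oU)) mulmxBl -[V^T *m U *m _]mulmxA.
    rewrite orthogonalr// mulmx1 -frobT linearB /= !trmx_mul !trmxK mulmxA.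
    by [].
  have -> : block_mx 0 (U *m V - V *m W) (W *m V^T - V^T *m U) 0 =
     block_mx 0 (U *m V - V *m W) 0 0 + block_mx 0 0 (W *m V^T - V^T *m U) 0.
    by rewrite add_block_mx !addr0 !add0r.
  apply: le_trans (frobD _ _) _.
  have f1 (Y : 'M[R]_(n, m)) : frob (block_mx 0 Y 0 0 : 'M[R]_(n + m)) = frob Y.
    apply: frob_eq; rewrite !mxdot_tr tr_block_mx mulmx_block mxtrace_block.
    by rewrite !trmx0 !(mulmx0, mul0mx, addr0, add0r) mxtrace0 addr0.
  have f2 (Y : 'M[R]_(m, n)) : frob (block_mx 0 0 Y 0 : 'M[R]_(n + m)) = frob Y.
    apply: frob_eq; rewrite !mxdot_tr tr_block_mx mulmx_block mxtrace_block.
    by rewrite !trmx0 !(mulmx0, mul0mx, addr0, add0r) mxtrace0 add0r.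
  by rewrite f1 f2 e1 e2; lra.
move=> X.
rewrite (_ : _ - _ = (U - U') *m X *m W^T + U' *m X *m (W - W')^T); last first.
  by rewrite [(W - W')^T]linearB /= !mulmxBl mulmxBr addrA subrK.
apply: le_trans (frobD _ _) _; rewrite frob_orthr; last exact: orthogonalT.
rewrite -[U' *m _ *m _]mulmxA (frob_orthl _ oU').
apply: le_trans (lerD (frobM _ _) (frobM _ _)) _; rewrite frobT.
have := frob_ge0 X.
have : frob (U - U') <= c * (2 * frob (U *m V *m W^T - V)).
  by apply: le_trans BU _; apply: le_trans BQ _; rewrite ler_pM2l.
have : frob (W - W') <= c * (2 * frob (U *m V *m W^T - V)).
  by apply: le_trans BW _; apply: le_trans BQ _; rewrite ler_pM2l.
nra.
Qed.

Lemma singular_system :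
  spectral_system (fun X : emx R n m => singvals X)
    svddiag
    [set A | exists UW, [/\ orthogonal UW.1, orthogonal UW.2 & A = equivconj UW]].
Proof.
split.
- move=> _ [[U W] [oU oW ->]] a X Y.
  by rewrite /equivconj /= mulmxDr mulmxDl -scalemxAr -scalemxAl.
- move=> _ X Y [[U W] [oU oW ->]]; rewrite -[LHS]/(mxdot _ _) mxdot_orthr.
    by rewrite mxdot_orthl.
  exact: orthogonalT.
- move=> _ _ [[U W] [oU oW ->]] [[U' W'] [oU' oW' ->]].
  exists (U *m U', W *m W'); split; [exact: orthogonalM|exact: orthogonalM|].
  by apply: funext => X; rewrite /equivconj /= trmx_mul !mulmxA.
- move=> _ [[U W] [oU oW ->]]; exists (equivconj (U^T, W^T)).
    by exists (U^T, W^T); split=> //; exact: orthogonalT.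
  move=> X; rewrite /equivconj /= trmxK -!mulmxA orthogonalr// mulmx1.
  by rewrite orthogonalKr.
- move=> u v; rewrite -[LHS]/(mxdot _ _) (mxdot_rect_diag nm).
  by rewrite [RHS]mxdotE; apply: eq_bigr => i _; rewrite big_ord1 mxE eqxx.
- move=> X; have [U [W [oU oW XE]]] := singvals_decompose X nm.
  by exists (equivconj (U, W)) => //; exists (U, W).
- move=> _ X [[U W] [oU oW ->]] /=.
  have [U' [W' [oU' oW' XE]]] := singvals_decompose X nm.
  rewrite /equivconj /svddiag /= (singvals_conj _ oU oW) [in RHS]XE.
  by rewrite (singvals_conj _ oU' oW').
- by move=> X Y; exact: singvals_trace.
- move=> V; have [c c0 cP] := singular_orbit V.
  exists c => // _ [[U W] [oU oW ->]].
  have [U' [W' [oU' oW' UV UX]]] := cP U W oU oW.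
  exists (equivconj (U', W')); first by exists (U', W').
  by split=> // X; exact: UX.
Qed.

End RectangularSystem.

Section SpectralSubregularity.
Context (R : realType).

Lemma subdiff_orthogonal n (g : vec R n -> \bar R) (P : 'M[R]_n) (x v : vec R n) :
  orthogonal P -> (forall u : vec R n, g (P *m u) = g u) ->
  subdiff g (P *m x) (P *m v) <-> subdiff g x v.
Proof.
move=> oP gP.
have E (y : 'cV[R]_n) :
    dotp (P *m v : vec R n) (P *m y - P *m x) = dotp v (y - x : vec R n).
  by rewrite -mulmxBr -[LHS]/(mxdot _ _) mxdot_orthl.
split=> H y; last by rewrite -(orthogonalKr y oP) E !gP.
by have := H (P *m y); rewrite E !gP.
Qed.

Lemma subregular_orthogonal n (g : vec R n -> \bar R) (P : 'M[R]_n) (x v : vec R n) :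
  orthogonal P -> (forall u : vec R n, g (P *m u) = g u) ->
  subregular_at (subdiff g) (P *m x) (P *m v) -> subregular_at (subdiff g) x v.
Proof.
move=> oP gP [eps [k [e0 k0 H]]]; exists eps, k; split=> // u w ux wv uw.
have E (a b : 'cV[R]_n) : `|P *m a - P *m b : vec R n| = `|a - b : vec R n|.
  by rewrite -mulmxBr; exact: frob_orthl.
have [|||z zv uz] := H (P *m u) (P *m w); [by rewrite E|by rewrite E| |].
  exact/subdiff_orthogonal.
exists (P^T *m z); first by apply/(subdiff_orthogonal _ _ oP gP); rewrite orthogonalKr.
by rewrite -E orthogonalKr//; move: uz; rewrite E.
Qed.

(** On symmetric matrices, an absolutely symmetric function of the singular
    values is the same function of the eigenvalues, and a signed permutation
    carries the hypothesis from one spectrum to the other. *)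
Lemma spectral_subregular (s : spectral_setting) (g : vec R (spec_dim s) -> \bar R)
    (X V : mspace R s) : proper_fun g -> spectral_symmetry g ->
  (forall v, subdiff g (spectrum X) v -> subregular_at (subdiff g) (spectrum X) v) ->
  subdiff (fun Y => g (spectrum Y)) X V ->
  subregular_at (subdiff (fun Y => g (spectrum Y))) X V.
Proof.
move=> gp; case: s g X V gp => [n m nm|n|n] /= g X V gp gs sub XV.
- have sys := singular_system R nm.
  have gG A u : [set A | exists UW, [/\ orthogonal UW.1, orthogonal UW.2 &
      A = equivconj UW]] A -> g (singvals (A (svddiag m u))) = g u.
    move=> [[U W] [oU oW ->]]; have [P sP E] := singvals_signed_perm u nm oU oW.
    by rewrite [singvals _]E gs.
  apply: (subregular_lift sys gp gG); apply: sub.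
  exact: (subdiff_spectral sys gp gG XV).1.
- have thetaE : (fun Y : symmx R n => g (singvals (vsval Y))) =
      fun Y => g (eigen_spectrum Y).
    apply: funext => Y; have [U oU YE] := eigvals_diagonalize (vsval_sym Y).
    have [P sP E] := singvals_signed_perm (eigvals (vsval Y)) (leqnn n) oU oU.
    by rewrite rect_diag_diag -YE in E; rewrite E gs.
  rewrite thetaE in XV *.
  have sys := eigen_system R n.
  have gG A u : [set A | exists2 U, orthogonal U & A = symconj U] A ->
      g (eigen_spectrum (A (symdiag u))) = g u.
    move=> [U oU ->]; rewrite /eigen_spectrum symconjE symdiagE.
    have := singvals_signed_perm u (leqnn n) oU oU => -[P sP E].
    have := eigvals_perm u oU => -[P' /is_perm_mxP[t ->] ->].
    rewrite -(gs (perm_mx t) u) //.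
    exists (const_mx 1), (perm_mx t); split.
    - by move=> i; left; rewrite mxE.
    - exact: perm_mx_is_perm.
    - by rewrite diag_const_mx mul1mx.
  apply: (subregular_lift sys gp gG).
  have [gXV _] := subdiff_spectral sys gp gG XV.
  have [U oU XE] := eigvals_diagonalize (vsval_sym X).
  have [P sP E] := singvals_signed_perm (eigvals (vsval X)) (leqnn n) oU oU.
  rewrite rect_diag_diag -XE in E.
  have gP u : g (P *m u) = g u by exact: gs.
  have oP := orthogonal_signed_perm sP.
  apply: (subregular_orthogonal oP gP).
  have := sub (P *m eigen_spectrum V); rewrite E; apply.
  exact/subdiff_orthogonal.
- have sys := eigen_system R n.
  have gG A u : [set A | exists2 U, orthogonal U & A = symconj U] A ->
      g (eigen_spectrum (A (symdiag u))) = g u.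
    move=> [U oU ->]; rewrite /eigen_spectrum symconjE symdiagE.
    by have [P sP E] := eigvals_perm u oU; rewrite E gs.
  apply: (subregular_lift sys gp gG); apply: sub.
  exact: (subdiff_spectral sys gp gG XV).1.
Qed.

End SpectralSubregularity.

(** * Polyhedral error bound *)

Section PolyhedralErrorBound.
Context (R : realType) (E : euclidType R) (k : nat).
Context (a : 'I_k -> E) (b : 'I_k -> R) (c : E) (gam : R).

Let P : set E := [set x | forall i, b i <= dotp (a i) x].
Let phi x := dotp c x - gam.

Hypothesis phi_ge0 : forall x, P x -> 0 <= phi x.
Context (x0 : E).
Hypothesis (Px0 : P x0) (phi0 : phi x0 = 0).

Let phiD x u t : phi (x + t *: u) = phi x + t * dotp c u.
Proof. by rewrite /phi dotpDr dotpZr; ring. Qed.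

(** The first blocking constraint minimizes the ratio [tau] of slack to rate of
    decrease. *)
Lemma first_exit x u (t : R) : P x -> 0 <= t -> ~ P (x + t *: u) ->
  exists j s, [/\ 0 <= s, s <= t, P (x + s *: u), dotp (a j) u != 0 &
    dotp (a j) (x + s *: u) = b j].
Proof.
move=> Px t0 nP.
have [i0 i0P] : exists i, dotp (a i) (x + t *: u) < b i.
  apply: contrapT => no; apply: nP => i; rewrite leNgt; apply/negP => h.
  by apply: no; exists i.
have nx i : b i <= dotp (a i) x by exact: Px.
have dE i s : dotp (a i) (x + s *: u) = dotp (a i) x + s * dotp (a i) u.
  by rewrite dotpDr dotpZr.
have i0u : dotp (a i0) u < 0.
  rewrite ltNge; apply/negP => h; have := nx i0.
  by move: i0P; rewrite dE; have : 0 <= t * dotp (a i0) u by [rewrite mulr_ge0]; lra.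
pose tau i := (dotp (a i) x - b i) / - dotp (a i) u.
have tauE i : dotp (a i) u < 0 -> dotp (a i) x - b i = tau i * - dotp (a i) u.
  by move=> h; rewrite /tau divfK// oppr_eq0 lt_eqF.
case: (@Order.TotalTheory.arg_minP _ _ 'I_k i0
  (fun i => dotp (a i) u < 0) tau i0u) => j ju jmin.
exists j, (tau j); split.
- by rewrite divr_ge0 ?subr_ge0 ?oppr_ge0 ?(ltW ju).
- apply: le_trans (jmin _ i0u) _; rewrite ler_pdivrMr ?oppr_gt0//.
  by move: i0P; rewrite dE; lra.
- move=> i; rewrite dE; have [iu|iu] := ltP (dotp (a i) u) 0; last first.
    have : 0 <= tau j * dotp (a i) u.
      by rewrite mulr_ge0 // divr_ge0 ?subr_ge0 ?oppr_ge0 ?(ltW ju).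
    by have := nx i; lra.
  have := tauE i iu; have := jmin i iu => h1 h2.
  have : tau j * - dotp (a i) u <= tau i * - dotp (a i) u.
    by rewrite ler_pM2r ?oppr_gt0.
  lra.
- by rewrite lt_eqF.
- by rewrite dE; have := tauE j ju; lra.
Qed.

Let near_zero x kap := exists z, [/\ P z, phi z = 0 & `|x - z| <= kap * phi x].

(** If the constant value of [phi] on the face is 0, the point itself is the
    required zero; if not, [phi] is bounded away from 0 and [x0] serves. *)
Lemma constant_face_bound (I : {set 'I_k}) (rho : R) : 0 <= rho ->
  (forall u, (forall i, i \in I -> dotp (a i) u = 0) -> dotp c u = 0) ->
  exists2 kap : R, 0 <= kap & forall x, P x ->
    (forall i, i \in I -> dotp (a i) x = b i) -> `|x - x0| <= rho ->
    near_zero x kap.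
Proof.
move=> rho0 cI.
have [[p [Pp pI]]|no] := pselect (exists p,
    P p /\ forall i, i \in I -> dotp (a i) p = b i); last first.
  by exists 0 => // x Px xI; exfalso; apply: no; exists x.
have phip x : (forall i, i \in I -> dotp (a i) x = b i) -> phi x = phi p.
  move=> xI; have : dotp c (x - p) = 0.
    by apply: cI => i iI; rewrite dotpBr xI// pI// subrr.
  by rewrite dotpBr /phi; lra.
have [p0|pN0] := eqVneq (phi p) 0.
  exists 0 => // x Px xI _; exists x.
  by rewrite subrr normr0 phip// p0 mulr0.
have p_gt0 : 0 < phi p by rewrite lt_neqAle eq_sym pN0 phi_ge0.
exists (rho / phi p); first by rewrite divr_ge0// ltW.
move=> x Px xI xr; exists x0; split=> //.
by rewrite phip// divfK.
Qed.

(** Downward induction on the set [I] of active constraints.  If [phi] is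
    nonconstant on the face, move down along a direction of the face until
    [phi] vanishes or a new constraint becomes active. *)
Lemma face_error_bound n (I : {set 'I_k}) (rho : R) : (#|~: I| < n)%N ->
  0 <= rho -> exists2 kap : R, 0 <= kap & forall x, P x ->
    (forall i, i \in I -> dotp (a i) x = b i) -> `|x - x0| <= rho ->
    near_zero x kap.
Proof.
elim: n I rho => [//|n IHn] I rho In rho0.
have [[u [uI cu]]|no] := pselect (exists u,
    (forall i, i \in I -> dotp (a i) u = 0) /\ dotp c u = -1); last first.
  apply: constant_face_bound => // u uI; apply/eqP; apply: contrapT => /negP cu.
  apply: no; exists (- (dotp c u)^-1 *: u); split.
    by move=> i iI; rewrite dotpZr uI// mulr0.
  by rewrite dotpZr mulNr mulVf.
pose rho' := rho + `|c| * rho * `|u|.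
have rho'0 : 0 <= rho' by rewrite addr_ge0 ?mulr_ge0.
have IH j : exists kap : R, 0 <= kap /\ (j \notin I -> forall x, P x ->
    (forall i, i \in j |: I -> dotp (a i) x = b i) -> `|x - x0| <= rho' ->
    near_zero x kap).
  have [jI|jI] := boolP (j \in I); first by exists 0.
  have [|kap k0 kP] := IHn (j |: I) rho' _ rho'0.
    apply: (@leq_trans #|~: I|) => //; apply: proper_card.
    rewrite properC; apply/properP; split; first exact: finset.subsetUr.
    by exists j => //; rewrite !inE eqxx.
  by exists kap; split.
have /choice[kap kapP] := IH.
have kap0 j : 0 <= kap j by have [] := kapP j.
exists (`|u| + \sum_j kap j); first by rewrite addr_ge0// sumr_ge0.
move=> x Px xI xr; have p0 := phi_ge0 Px.
have sum0 : 0 <= \sum_j kap j by rewrite sumr_ge0.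
have phi_rho : phi x <= `|c| * rho.
  have -> : phi x = dotp c (x - x0) by rewrite dotpBr; move: phi0; rewrite /phi; lra.
  by apply: le_trans (dotp_le _ _) _; rewrite ler_wpM2l.
have xu (t : R) : `|x - (x + t *: u)| = `|t| * `|u|.
  by rewrite opprD addrA subrr add0r normrN normrZ.
have [Pz|/(first_exit Px p0)[j [s [s0 sp Pz ju jz]]]] := pselect (P (x + phi x *: u)).
  exists (x + phi x *: u); split=> //; first by rewrite phiD cu; ring.
  by rewrite xu ger0_norm// mulrC mulrDl lerDl mulr_ge0.
have jI : j \notin I by apply: contra ju => /uI ->.
have [_ /(_ jI (x + s *: u) Pz)[|| z [Pz' z0 xz]]] := kapP j.
- move=> i; rewrite in_setU1 => /orP[/eqP ->//|iI].
  by rewrite dotpDr dotpZr uI// mulr0 addr0 xI.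
- rewrite (_ : x + s *: u - x0 = (x - x0) + s *: u); last by rewrite addrAC.
  apply: le_trans (ler_normD _ _) _; rewrite lerD// normrZ ger0_norm//.
  by rewrite ler_wpM2r// (le_trans sp).
exists z; split=> //.
rewrite (_ : x - z = (x - (x + s *: u)) + (x + s *: u - z)); last by rewrite addrA subrK.
apply: le_trans (ler_normD _ _) _; rewrite xu ger0_norm// mulrDl lerD//.
  by rewrite mulrC ler_wpM2l.
apply: le_trans xz _; apply: ler_pM => //.
- by rewrite phiD cu; lra.
- by rewrite (bigD1 j)//= lerDl sumr_ge0.
- by rewrite phiD cu; lra.
Qed.

Lemma polyhedral_error_bound (rho : R) : 0 <= rho ->
  exists2 kap : R, 0 <= kap & forall x, P x -> `|x - x0| <= rho ->
    exists z, [/\ P z, phi z = 0 & `|x - z| <= kap * phi x].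
Proof.
move=> rho0; have [kap k0 kP] := @face_error_bound _ finset.set0 rho (ltnSn _) rho0.
by exists kap => // x Px xr; apply: kP => // i; rewrite inE.
Qed.

End PolyhedralErrorBound.

(** * The growth condition *)

Section ConvexDifferentiable.
Context (R : realType) (E : euclidType R).

Lemma convex_closed_ball (x : E) (r : R) : 0 < r ->
  convex_set (closed_ball x r : set (convex_lmodType E)).
Proof.
move=> r0; apply/convex_setW => y z; rewrite !inE => yr zr l l0 l1.
move: yr zr => /(closed_ball_normP _ _ r0) yr /(closed_ball_normP _ _ r0) zr.
rewrite inE; apply/(closed_ball_normP _ _ r0).
rewrite -[X in `|X|]/(l%:num *: y + (1 - l%:num) *: z - x).
have -> : l%:num *: y + (1 - l%:num) *: z - x =
    l%:num *: (y - x) + (1 - l%:num) *: (z - x).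
  rewrite !scalerBr addrACA -opprD -scalerDl [l%:num + (1 - _)]addrCA subrr.
  by rewrite addr0 scale1r.
apply: le_trans (ler_normD _ _) _; rewrite !normrZ.
rewrite (@ger0_norm _ l%:num)// (@ger0_norm _ (1 - l%:num)); last first.
  by rewrite subr_ge0 ltW.
have := ltW l0; have := ltW l1; nra.
Qed.

(** Difference quotients along a segment are at most the slope of the chord. *)
Lemma convex_gradient_le (h : E -> \bar R) (x y : E) :
  proper_fun h -> convex_efun h -> h x \is a fin_num ->
  differentiable (fine \o h : E -> R^o) x ->
  (h x + (dotp (gradient (fine \o h) x) (y - x))%:E <= h y)%E.
Proof.
move=> [hNy _] hc hx dh.
have := hNy y; case hyE : (h y) => [b| |] // _; last by rewrite leey.
case hxE : (h x) hx => [a| |] // _; rewrite -EFinD lee_fin -gradientP.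
set f : E -> R^o := fine \o h.
rewrite leNgt; apply/negP => lt.
have cv : derivable f x (y - x) by exact: diff_derivable.
have {cv} : (fun t => t^-1 *: ((f \o shift x) (t *: (y - x)) - f x)) @ 0^'
    --> ('d f x (y - x) : R^o).
  by rewrite -deriveE//; exact: cv.
move=> /cvgrPdist_lt /(_ ('d f x (y - x) - (b - a))); rewrite subr_gt0.
move=> /(_ _)[|e /= e0 eP]; first by lra.
pose t : R := Num.min (e / 2) 1.
have t0 : 0 < t by rewrite lt_min ltr01 divr_gt0.
have t1 : t <= 1 by rewrite ge_min lexx orbT.
have te : t < e.
  by apply: (@le_lt_trans _ _ (e / 2)); [rewrite ge_min lexx|lra].
have := eP t; rewrite /= sub0r normrN gtr0_norm// => /(_ te (lt0r_neq0 t0)).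
have xt : t *: (y - x) + x = t *: y + (1 - t) *: x.
  by rewrite scalerBr scalerBl scale1r addrA addrAC.
have := hc y x t; rewrite (ltW t0) t1 => /(_ isT); rewrite hyE hxE -!EFinM -EFinD.
rewrite /f /= xt hxE /=.
have := hNy (t *: y + (1 - t) *: x).
case: (h _) => [r| |] //= _; rewrite lee_fin => rle.
move=> lt2; have {lt2} := le_lt_trans (ler_norm _) lt2.
rewrite -[t^-1 *: _]/(t^-1 * (r - a)).
have : t^-1 * (r - a) <= b - a by rewrite ler_pdivrMl//; move: rle; lra.
by move: ('d f x (y - x)) => D; lra.
Qed.

(** Strong convexity at the midpoint of [x] and [y], combined with the gradient
    inequality there. *)
Lemma strongly_convex_gradient_le (h : E -> \bar R) (K : set E) (x : E) :
  proper_fun h -> convex_efun h -> h x \is a fin_num ->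
  differentiable (fine \o h : E -> R^o) x -> K x -> strongly_convex_on h K ->
  exists2 mu : R, 0 < mu & forall y, K y ->
    (h x + (dotp (gradient (fine \o h) x) (y - x) + mu * `|y - x| ^+ 2)%:E
      <= h y)%E.
Proof.
move=> hp hc hx dh Kx [mu mu0 H]; exists (mu / 4); first by rewrite divr_gt0.
move=> y Ky; have := hp.1 y; case hyE : (h y) => [b| |] // _; last by rewrite leey.
have half : 0 <= (2^-1 : R) <= 1 by lra.
have := H y x 2^-1 Ky Kx half.
have yx : 2^-1 *: y + (1 - 2^-1) *: x - x = 2^-1 *: (y - x).
  by rewrite scalerBr scalerBl scale1r addrA addrAC addrK.
have := convex_gradient_le (2^-1 *: y + (1 - 2^-1) *: x) hp hc hx dh.
rewrite yx dotpZr hyE; case: (h x) hx => [a| |] //= _.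
have := hp.1 (2^-1 *: y + (1 - 2^-1) *: x).
case: (h _) => [r| |] //= _.
rewrite -!EFinM -!EFinD !lee_fin; lra.
Qed.

End ConvexDifferentiable.

Section QuadraticGrowth.
Context (R : realType) (X : euclidType R) (d e : nat) (p : problem X d e).
Local Notation h := (pb_h p).
Local Notation F := (pb_F p).
Local Notation C := (pb_C p).
Local Notation theta := (pb_theta p).
Local Notation A := (pb_A p).
Local Notation b := (pb_b p).
Local Notation Q := (pb_Q p).

(** Complementarity; the cone [Q] equals its bidual because the normals of its
    faces are themselves dual vectors. *)
Lemma complementarity x y : polyhedral_cone Q ->
  [set A x - b + u | u in normal_cone (dual_cone Q) y] 0 <->
  [/\ dual_cone Q y, Q (A x - b) & dotp y (A x - b) = 0].
Proof.
move=> [k [a QE]]; split=> [[u [yQ un] /eqP]|[yQ qQ yq]].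
  rewrite addr_eq0 eq_sym eqr_oppLR => /eqP uE; set q := A x - b in uE *.
  have q0 y' : dual_cone Q y' -> dotp q y <= dotp q y'.
    by move=> /un; rewrite uE dotpNl dotpBr; lra.
  have cone0 : dual_cone Q 0 by move=> z _; rewrite dotp0l.
  have cone2 : dual_cone Q (y + y).
    by move=> z Qz; rewrite dotpDl addr_ge0//; exact: yQ.
  have qy : dotp q y = 0.
    have := q0 _ cone0; have := q0 _ cone2; rewrite dotpDr dotp0r => h1 h2.
    by apply/le_anti/andP; split; lra.
  split=> //; last by rewrite dotpC.
  rewrite QE => i /=; rewrite dotpC -qy; apply: q0 => z.
  by rewrite QE => /(_ i).
exists (- (A x - b)); last by rewrite subrr.
split=> // y' y'Q; rewrite dotpNl dotpBr [dotp _ y]dotpC yq subr0 oppr_le0 dotpC.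
exact: y'Q.
Qed.

Context (xbar : X) (ybar : vec R e).
Hypothesis (hstd : standing_assumptions p).
Hypothesis (hopt : primal_solutions p xbar).
Hypothesis (hmult : multipliers p xbar ybar).

Let grad : vec R d := grad_h p (F xbar).
Let V : X := adjoint A ybar - (adjoint F grad + C).

Let theta_subdiff : subdiff theta xbar V.
Proof.
have [[v vt /eqP vE] _] := hmult; suff <- : v = V by [].
apply/eqP; move: vE; rewrite addrC addr_eq0 => /eqP ->; apply/eqP.
by rewrite /V opprD opprB addrAC [in RHS]opprD addrA addrAC -!addrA.
Qed.

Let compl : [/\ dual_cone Q ybar, Q (A xbar - b) & dotp ybar (A xbar - b) = 0].
Proof. by have [_ _ Qp _ _] := hstd; apply/complementarity => //; have [] := hmult. Qed.

Let fin_values : h (F xbar) \is a fin_num /\ theta xbar \is a fin_num.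
Proof.
have [[hp _ _ _] [tp _ _] _ _ _] := hstd; have [_ + _] := hopt.
rewrite /primal_obj; have := hp.1 (F xbar); have := tp.1 xbar.
by case: (h _) => [?| |] //; case: (theta _) => [?| |].
Qed.

(** [V] is such that the gradients add up to [adjoint A ybar]; complementarity
    at [xbar] absorbs the constant. *)
Let linear_parts x : dotp grad (F x - F xbar) + dotp C (x - xbar) +
  dotp V (x - xbar) = dotp ybar (A x - b).
Proof.
have [_ _ y0] := compl; rewrite -[RHS]subr0 -[in RHS]y0 -dotpBr.
rewrite opprB addrA subrK -!linearB dotpC adjointP dotpC.
rewrite [in RHS]dotpC [in RHS]adjointP [in RHS]dotpC.
rewrite /V dotpBl dotpDl; ring.
Qed.

Let solutions x : V_P p xbar x -> G1_P p xbar ybar x -> G2_P p ybar x ->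
  primal_solutions p x.
Proof.
have [[hp hc _ h1] [tp _ _] Qp _ _] := hstd.
move=> xV x1 /(complementarity _ _ Qp)[yQ qQ yq].
have [_ _ xbmin] := hopt.
have xmin y : primal_feasible p y -> (primal_obj p x <= primal_obj p y)%E.
  move=> Qy; rewrite /primal_obj xV.
  have [hx _] := fin_values.
  have hdom : edom h (F xbar) by rewrite /edom /= ltey_eq hx.
  have tx := subdiff_fin tp x1.
  have := convex_gradient_le (F y) hp hc hx (h1 _ hdom).1.
  have := x1 y; rewrite -/grad -/V.
  have : 0 <= dotp ybar (A y - b) by exact: yQ.
  have := linear_parts y; have := linear_parts x; rewrite yq xV subrr dotp0r.
  rewrite -/(grad_h p _) -/grad !dotpBr.
  case: (h (F xbar)) hx => [a| |] // _; case: (theta x) tx => [t| |] // _.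
  have := tp.1 y; have := hp.1 (F y).
  case: (h (F y)) => [a'| |] //; case: (theta y) => [t'| |] // _ _.
  - by rewrite -!EFinD !lee_fin; lra.
  - by move=> *; rewrite addey// leey.
  - by move=> *; rewrite !addye// leey.
  - by move=> *; rewrite addey// leey.
split=> //.
rewrite /primal_obj xV; have [hx _] := fin_values.
have := subdiff_fin tp x1.
by case: (h _) hx => [?| |] //; case: (theta _).
Qed.

(** On the feasible set, the dual slack is an affine function with minimum 0,
    and [G2_P] is the set where it vanishes. *)
Let dual_slack_error_bound :
  exists2 k3 : R, 0 <= k3 & forall x, primal_feasible p x ->
    `|x - xbar| <= 1 ->
    exists2 z, G2_P p ybar z & `|x - z| <= k3 * dotp ybar (A x - b).
Proof.
have [_ _ Qp _ _] := hstd; have [yQ qQ yq] := compl.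
have [k [a QE]] := Qp.
have aE y x : dotp (adjoint A y) x = dotp y (A x).
  by rewrite dotpC -adjointP dotpC.
have QP x : Q (A x - b) <-> forall i, dotp (a i) b <= dotp (adjoint A (a i)) x.
  rewrite QE; split=> H i; have := H i; rewrite aE dotpBr; lra.
have [|||k3 k30 k3P] := @polyhedral_error_bound _ X k (fun i => adjoint A (a i))
  (fun i => dotp (a i) b) (adjoint A ybar) (dotp ybar b) _ xbar _ _ 1 ler01.
- by move=> x /QP Qx; rewrite aE -dotpBr; exact: yQ.
- exact/QP.
- by rewrite aE -dotpBr.
exists k3 => // x /QP Qx x1; have [z [/QP Qz z0 xz]] := k3P x Qx x1.
exists z; last by move: xz; rewrite aE -dotpBr.
by apply/(complementarity _ _ Qp); split=> //; rewrite dotpBr -aE.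
Qed.

(** The objective minus its minimum is at least the sum of three terms, one for
    each set of the regular collection: strong convexity of [h] controls the
    distance to [V_P], the growth of [theta] the distance to [G1_P], and the
    dual slack the distance to [G2_P].  The slack bounds that distance itself,
    hence its square near [xbar]. *)
Lemma quadratic_growth :
  (forall K : set (vec R d), K `<=` edom h -> compact K ->
     convex_set (K : set (convex_lmodType (vec R d))) ->
     strongly_convex_on h K) ->
  (forall v, subdiff theta xbar v -> subregular_at (subdiff theta) xbar v) ->
  bounded_linear_regular
    (tnth [tuple V_P p xbar; G1_P p xbar ybar; G2_P p ybar]) ->
  exists delta kappa : R, [/\ 0 < delta, 0 < kappa &
    forall x, primal_feasible p x -> closed_ball xbar delta x ->
      (primal_obj p xbar + kappa%:E * edist_inf (primal_solutions p) x ^+ 2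
       <= primal_obj p x)%E].
Proof.
have [[hp hc ho h1] [tp tc tl] Qp _ _] := hstd.
move=> strong subreg [_ _ _ reg].
have [hx tx] := fin_values.
have hdom : edom h (F xbar) by rewrite /edom /= ltey_eq hx.
have [yQ qQ yq] := compl.
have [r r0 rdom] : exists2 r : R, 0 < r & closed_ball (F xbar) r `<=` edom h.
  have /nbhs_ballP[r /= r0 rP] := ho _ hdom.
  exists (r / 2); first by rewrite divr_gt0.
  move=> u /closed_ball_normP; rewrite divr_gt0// => /(_ isT) ur; apply: rP.
  by rewrite -ball_normE /= distrC; move: ur r0; lra.
have [||mu mu0 smooth] := @strongly_convex_gradient_le _ _ h (closed_ball (F xbar) r)
    _ hp hc hx (h1 _ hdom).1.
- by apply/(closed_ball_normP _ _ r0); rewrite subrr normr0 ltW.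
- apply: strong => //; first exact: closed_ball_compact.
  exact: convex_closed_ball.
have [cF cF0 cFP] := linear_bounded F.
have [cK cK0 cKP] := dist_ker_le F.
have [dl [k2 [dl0 k20 spectral]]] :=
  subregular_growth tp tc tl theta_subdiff (subreg _ theta_subdiff).
have [k3 k30 poly] := dual_slack_error_bound.
pose delta := Num.min (Num.min dl 1) (r / cF).
have delta0 : 0 < delta by rewrite !lt_min dl0 ltr01 divr_gt0.
have [|k4 k40 k4P] := reg (closed_ball xbar delta).
  by apply: compact_bounded; exact: closed_ball_compact.
pose L := `|adjoint A ybar|; have L0 : 0 <= L by exact: normr_ge0.
pose M := cK ^+ 2 / mu + k2^-1 + k3 ^+ 2 * L.
have M0 : 0 < M.
  apply: ltr_pwDl; last by rewrite mulr_ge0 ?sqr_ge0 ?L0.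
  by rewrite addr_gt0 ?invr_gt0 ?divr_gt0 ?exprn_gt0.
exists delta, (k4 ^+ 2 * M)^-1; split=> //; first by rewrite invr_gt0 mulr_gt0 ?exprn_gt0.
move=> x Qx xball; have /(closed_ball_normP _ _ delta0) := xball.
rewrite !le_min => /andP[/andP[xdl x1] xr].
have Fxr : closed_ball (F xbar) r (F x).
  apply/closed_ball_normP => //; rewrite -linearB; apply: le_trans (cFP _) _.
  by rewrite mulrC -ler_pdivlMr.
have [z2 z2G xz2] := spectral x xdl.
have [z3 z3G xz3] := poly x Qx x1.
have [k Fk xk] := cKP (x - xbar).
pose z1 := xbar + k.
have z1V : V_P p xbar z1 by rewrite /V_P /= linearD Fk addr0.
have xz1 : `|x - z1| <= cK * `|F x - F xbar|.
  by rewrite -linearB /z1 opprD addrA.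
set phi := dotp ybar (A x - b) in xz3.
have phi0 : 0 <= phi by exact: yQ.
have phiL : phi <= L.
  have -> : phi = dotp (adjoint A ybar) (x - xbar).
    rewrite dotpC -adjointP linearB dotpC /phi -[LHS]subr0 -[X in _ - X]yq -dotpBr.
    by rewrite opprB addrA subrK.
  apply: le_trans (dotp_le _ _) _; rewrite -[leRHS]mulr1 ler_wpM2l//.
(* the square root of [S] bounds the distances to all three sets *)
pose S := `|x - z1| ^+ 2 + `|x - z2| ^+ 2 + `|x - z3| ^+ 2.
have S0 : 0 <= S by rewrite !addr_ge0 ?sqr_ge0.
have le_sqrtS (z : X) : `|x - z| ^+ 2 <= S -> `|x - z| <= Num.sqrt S.
  by move=> zS; rewrite -[leLHS]ger0_norm// -sqrtr_sqr ler_wsqrtr.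
have dist_fin := edist_inf_fin x hopt.
have distS : (edist_inf (primal_solutions p) x <= (k4 * Num.sqrt S)%:E)%E.
  apply: (@le_trans _ _ (edist_inf (\bigcap_i tnth [tuple V_P p xbar;
      G1_P p xbar ybar; G2_P p ybar] i) x)).
    apply: ereal_inf_le_tmp; apply: image_subset => z zD.
    apply: solutions; [exact: (zD ord0)|exact: (zD (Ordinal (isT : 1 < 3)%N))|].
    exact: (zD (Ordinal (isT : 2 < 3)%N)).
  apply: le_trans (k4P x xball) _; rewrite EFinM lee_pmul2l ?lte_fin//.
  apply: bigmax_le => [|i _]; first by rewrite lee_fin sqrtr_ge0.
  have dz z (D : set X) : D z -> `|x - z| ^+ 2 <= S ->
      (edist_inf D x <= (Num.sqrt S)%:E)%E.
    move=> Dz zS; apply: le_trans (edist_inf_le x Dz) _.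
    by rewrite lee_fin le_sqrtS.
  case: i => [[|[|[|//]]] i3]; rewrite (tnth_nth set0) /=.
  - by apply: (dz z1) => //; rewrite /S -addrA lerDl addr_ge0 ?sqr_ge0.
  - by apply: (dz z2) => //; rewrite /S addrAC lerDr addr_ge0 ?sqr_ge0.
  - by apply: (dz z3) => //; rewrite /S lerDr addr_ge0 ?sqr_ge0.
have SM : S <= M * (mu * `|F x - F xbar| ^+ 2 + k2 * `|x - z2| ^+ 2 + phi).
  have e1 : `|x - z1| ^+ 2 <= cK ^+ 2 / mu * (mu * `|F x - F xbar| ^+ 2).
    rewrite mulrA divfK ?gt_eqF// -exprMn lerXn2r ?nnegrE// mulr_ge0//.
    exact: ltW.
  have e2 : `|x - z2| ^+ 2 = k2^-1 * (k2 * `|x - z2| ^+ 2).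
    by rewrite mulKf ?gt_eqF.
  have e3 : `|x - z3| ^+ 2 <= k3 ^+ 2 * L * phi.
    apply: (@le_trans _ _ ((k3 * phi) ^+ 2)).
      by rewrite lerXn2r ?nnegrE ?mulr_ge0.
    by rewrite exprMn -[leRHS]mulrA ler_wpM2l ?sqr_ge0// expr2 ler_wpM2r.
  have f1 : 0 <= mu * `|F x - F xbar| ^+ 2 by rewrite mulr_ge0 ?sqr_ge0 ?ltW.
  have f2 : 0 <= k2 * `|x - z2| ^+ 2 by rewrite mulr_ge0 ?sqr_ge0 ?ltW.
  have c1 : 0 <= cK ^+ 2 / mu by rewrite divr_ge0 ?sqr_ge0 ?ltW.
  have c2 : 0 <= k2^-1 by rewrite invr_ge0 ltW.
  have c3 : 0 <= k3 ^+ 2 * L by rewrite mulr_ge0 ?sqr_ge0 ?L0.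
  have sum (c u v w : R) : 0 <= c -> 0 <= v -> 0 <= w -> c * u <= c * (u + v + w).
    by move=> ? ? ?; rewrite ler_wpM2l// -addrA lerDl addr_ge0.
  rewrite /S /M 2!mulrDl; apply: lerD; first apply: lerD.
  - by apply: le_trans e1 _; exact: sum.
  - by rewrite {1}e2 addrAC [in leRHS]addrC addrA ler_wpM2l// -addrA lerDl addr_ge0.
  - by apply: le_trans e3 _; rewrite ler_wpM2l// lerDr addr_ge0.
have := smooth (F x) Fxr; have := xz2; have := linear_parts x; rewrite -/phi.
rewrite -[gradient _ _]/grad /primal_obj.
rewrite -(fineK dist_fin) -EFin_expe -EFinM.
have dist0 : 0 <= fine (edist_inf (primal_solutions p) x).
  by rewrite fine_ge0 ?edist_inf_ge0.
move: distS; rewrite -{1}(fineK dist_fin) lee_fin => distS.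
have kS : (k4 ^+ 2 * M)^-1 * fine (edist_inf (primal_solutions p) x) ^+ 2 <= M^-1 * S.
  rewrite invfM mulrAC mulrC ler_wpM2l ?invr_ge0 ?(ltW M0)//.
  rewrite ler_pdivrMl ?exprn_gt0// -[X in _ * X](sqr_sqrtr S0) -exprMn.
  by rewrite lerXn2r ?nnegrE ?mulr_ge0 ?sqrtr_ge0 ?(ltW k40).
have {SM} : M^-1 * S <= mu * `|F x - F xbar| ^+ 2 + k2 * `|x - z2| ^+ 2 + phi.
  by rewrite ler_pdivrMl.
move: kS; move: (_ * fine _ ^+ 2) => kd.
case: (h (F xbar)) hx => [a0| |] // _; case: (theta xbar) tx => [t0| |] // _.
have := tp.1 x; have := hp.1 (F x).
case: (h (F x)) => [a| |] //; case: (theta x) => [t| |] // _ _.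
- by rewrite !dotpBr -!EFinD !lee_fin; lra.
- by move=> *; rewrite addey// leey.
- by move=> *; rewrite !addye// leey.
- by move=> *; rewrite addey// leey.
Qed.

End QuadraticGrowth.

Theorem theorem16 (R : realType) (s : spectral_setting) (d e : nat)
    (p : problem (mspace R s) d e) (g : vec R (spec_dim s) -> \bar R)
    (Xbar : mspace R s) :
  standing_assumptions p ->
  proper_fun g -> convex_efun g -> lower_semicontinuous g ->
  spectral_symmetry g ->
  (forall X, pb_theta p X = g (spectrum X)) ->
  primal_solutions p Xbar ->
  multipliers p Xbar !=set0 ->
  (forall K : set (vec R d), K `<=` edom (pb_h p) -> compact K ->
     convex_set (K : set (convex_lmodType (vec R d))) ->
     strongly_convex_on (pb_h p) K) ->
  (forall v, subdiff g (spectrum Xbar) v ->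
     metrically_subregular (subdiff g) (spectrum Xbar) v) ->
  (exists2 y, multipliers p Xbar y &
     bounded_linear_regular
       (tnth [tuple V_P p Xbar; G1_P p Xbar y; G2_P p y])) ->
  exists delta kappa : R, [/\ 0 < delta, 0 < kappa &
    forall X, primal_feasible p X -> closed_ball Xbar delta X ->
      (primal_obj p Xbar + kappa%:E * edist_inf (primal_solutions p) X ^+ 2
       <= primal_obj p X)%E].
Proof.
move=> std gp _ _ gsym thetaE opt _ strong sub [y ymult reg].
have tE : pb_theta p = fun X => g (spectrum X) by apply: funext.
apply: (quadratic_growth std opt ymult strong _ reg) => V; rewrite tE.
apply: spectral_subregular => // v /sub; exact: metrically_subregular_at.
Qed.
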